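(* Let $I\subset\mathscr L_1$ be an ideal and let $\xi\in(\ell^1)^*$. Then the following conditions are equivalent. (i) $\xi\in\Sigma(I^{-\infty})$. (ii) $\xi\prec_\infty\eta$ for some $\eta\in\Sigma(I)$. (ii$'$) $\xi\preccurlyeq_\infty\eta$ for some $\eta\in\Sigma(I)$. (ii$''$) $\eta\preccurlyeq\xi$ for some $\eta\in\Sigma(I)$. (iii) $P\xi\in\Sigma(I)$ for some column-stochastic matrix $P$. (iii$'$) $Q\xi\in\Sigma(I)$ for some block orthostochastic matrix $Q$. (iv) $E(V\operatorname{diag}\xi\,V^* )\in I$ for some isometry $V$. (iv$'$) $E(U\operatorname{diag}\xi\,U^* )\in I$ for some matrix $U$ that is a direct sum of finite orthogonal matrices.
   Context: $\mathrm{c}_{\mathrm{o}}^*$ denotes the cone of nonnegative monotone nonincreasing sequences converging to $0$, and $(\ell^1)^*$ the subcone of summable ones (neither denotes a dual space). For $\xi,\eta\in \mathrm{c}_{\mathrm{o}}^*$, $\xi\preccurlyeq\eta$ means $\sum_{j=1}^n\xi_j\le\sum_{j=1}^n\eta_j$ for every $n\in\mathbb N$ and $\liminf_n\sum_{j=1}^n(\eta_j-\xi_j)=0$. For $\xi,\eta\in(\ell^1)^*$: $\xi\prec_\infty\eta$ means $\sum_{j=n}^\infty\xi_j\le\sum_{j=n}^\infty\eta_j$ for every $n\in\mathbb N$; $\xi\preccurlyeq_\infty\eta$ means $\xi\prec_\infty\eta$ and $\sum_{j=1}^\infty\xi_j=\sum_{j=1}^\infty\eta_j$. $H$ is a complex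 separable infinite-dimensional Hilbert space with a fixed orthonormal basis; infinite matrices are identified with operators. $\operatorname{diag}\rho$ is the diagonal operator with diagonal $\rho$, and $E(A)$ is the diagonal operator with the same main diagonal as $A\in B(H)$. A matrix with nonnegative entries is column-stochastic if all its row sums are at most $1$ and all its column sums equal $1$. An orthogonal matrix is a unitary matrix with real entries. $Q$ is block orthostochastic if $Q_{ij}=(U_{ij})^2$ for all $i,j$ with $U$ a direct sum of finite orthogonal matrices. $P\xi:=\langle\sum_jP_{ij}\xi_j\rangle_i$. An ideal is a nonzero two-sided ideal of $B(H)$ contained in the compact operators; $\mathscr L_1$ is the trace class. $s(X)$ is the nonincreasing sequence of singular numbers of a compact operator $X$ (with multiplicity, with infinitely many zeros added if $X$ has finite rank). The characteristic set of $I$ is $\Sigma(I):=\{s(X)\mid X\in I\}\subset \mathrm{c}_{\mathrm{o}}^*$; it determines $I$ (Calkin). For $\xi\in(\ell^1)^*$, $\xi_{a_\infty}:=\langle\frac1n\sum_{j=n+1}^\infty\xi_j\rangle$. The ideals ${}_{a_\infty}I$ and $I_{a_\infty}$ have characteristic sets $\Sigma({}_{a_\infty}I)=\{\xi\in(\ell^1)^*\mid\xi_{a_\infty}\in\Sigma(I)\}$ and $\Sigma(I_{a_\infty})=\{\xi\in \mathrm{c}_{\mathrm{o}}^*\mid\xi=O(\eta_{a_\infty})\text{ for some }\eta\in\Sigma(I\cap\mathscr L_1)\}$, where $\xi=O(\zeta)$ means $\xi_n\le M\zeta_n$ for some $M>0$ and all $n$. The am-$\infty$ closure of $I$ is $I^{-\infty}:={}_{a_\infty}(I_{a_\infty})$.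 *)

(* Defs.v *)
From HB Require Import structures.
From mathcomp Require Import all_boot all_order all_algebra.
From mathcomp Require Import complex.
From mathcomp Require Import all_classical all_reals all_analysis.

Set Implicit Arguments.
Unset Strict Implicit.
Unset Printing Implicit Defensive.

Import Order.TTheory GRing.Theory Num.Theory.
Import numFieldNormedType.Exports.

Local Open Scope classical_set_scope.
Local Open Scope ring_scope.
Local Open Scope complex_scope.

(* Sequences are indexed from 0: the term usually written [xi_n], n >= 1, is
   [xi n.-1]. *)
Section Sequences.
Context {R : realType}.
Implicit Types xi eta zeta : nat -> R.

Definition c0star : set (nat -> R) :=
  [set xi | [/\ forall n, 0 <= xi n, nonincreasing_seq xi
              & xi @ \oo --> (0 : R)]].

Definition l1star : set (nat -> R) :=
  [set xi | c0star xi /\ cvgn (series xi)].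

(* The partial sums live in the extended reals since, for general sequences in
   [c0star], their differences may diverge to +oo. *)
Definition strong_majorized xi eta :=
  [/\ c0star xi, c0star eta,
      forall n, \sum_(j < n) xi j <= \sum_(j < n) eta j
    & limn_einf (fun n => (\sum_(j < n) (eta j - xi j))%:E) = 0%E].

Definition majorized_oo xi eta :=
  [/\ l1star xi, l1star eta
    & forall n, \big[+%R/0]_(n <= j <oo) xi j <= \big[+%R/0]_(n <= j <oo) eta j].

Definition strong_majorized_oo xi eta :=
  majorized_oo xi eta /\ \big[+%R/0]_(0 <= j <oo) xi j = \big[+%R/0]_(0 <= j <oo) eta j.

Definition seqO xi zeta := exists2 M : R, 0 < M & forall n, xi n <= M * zeta n.

(* Arithmetic mean at infinity, [1/n * \sum_(j > n) xi_j] with indices from 1: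
   its entry of index [n] is the one for [n + 1]. *)
Definition am_oo xi : nat -> R :=
  fun n => n.+1%:R^-1 * \big[+%R/0]_(n.+1 <= j <oo) xi j.

Definition column_stochastic (P : nat -> nat -> R) :=
  [/\ forall i j, 0 <= P i j,
      forall i, (\sum_(0 <= j <oo) (P i j)%:E <= 1)%E
    & forall j, (\sum_(0 <= i <oo) (P i j)%:E = 1)%E].

Definition mxseq (P : nat -> nat -> R) xi : nat -> R :=
  fun i => \big[+%R/0]_(0 <= j <oo) (P i j * xi j).

(* [U] is the direct sum of the square blocks [B k] of size [(m k).+1]; the
   block [B k] starts at index [\sum_(l < k) (m l).+1]. *)
Definition orthogonal_direct_sum (U : nat -> nat -> R) :=
  exists (m : nat -> nat) (B : forall k, 'M[R]_((m k).+1)),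
    let pos k (p : 'I_(m k).+1) := (\sum_(l < k) (m l).+1 + p)%N in
    [/\ forall k, B k *m (B k)^T = 1%:M,
        forall k p q, U (pos k p) (pos k q) = B k p q
      & forall k l p q, k != l -> U (pos k p) (pos l q) = 0].

Definition block_orthostochastic (Q : nat -> nat -> R) :=
  exists2 U, orthogonal_direct_sum U & forall i j, Q i j = U i j ^+ 2.

End Sequences.

Section Operators.
Context {R : realType} {H : completeNormedModType R[i]}.
Variable dot : {dot H for Num.conj}.
Implicit Types (T S X V : H -> H) (I J : set (H -> H)) (e : nat -> H).

(* The norm of [H] is the one induced by the inner product, so that [H] is a
   Hilbert space; [dot] is linear in its first argument. *)
Definition hilbert_norm := forall x : H, `|x| ^+ 2 = dot x x.

Definition orthonormal_basis e :=
  (forall m n, dot (e m) (e n) = (m == n)%:R) /\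
  (forall x, series (fun n => dot x (e n) *: e n) @ \oo --> x).

Definition bounded_op T := linear T /\ continuous T.

Definition compact_op T :=
  bounded_op T /\ compact (closure (T @` [set x | `|x| <= 1])).

Definition adjoint T : H -> H :=
  xget (fun=> 0) [set S | forall x y, dot (T x) y = dot x (S y)].

Definition isometry_op V := bounded_op V /\ forall x, `|V x| = `|x|.

Definition has_dim (W : set H) (d : nat) :=
  exists v : 'I_d -> H,
    (forall c : 'rV[R[i]]_d, \sum_(k < d) c 0 k *: v k = 0 -> c = 0) /\
    (forall x, W x <-> exists c : 'rV[R[i]]_d, x = \sum_(k < d) c 0 k *: v k).

(* [s] is the sequence of singular numbers of [X]: the singular numbers are the
   square roots of the eigenvalues of [X^* X]. Only the values [t > 0] are
   counted with multiplicity, so that [s] is padded with zeros when [X] has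
   finite rank, and has no zero entry when [X] has infinite rank. *)
Definition singular_numbers X (s : nat -> R) :=
  c0star s /\
  forall t : R, 0 < t -> exists2 d : nat,
    has_dim [set v | adjoint X (X v) = (t ^+ 2)%:C *: v] d &
    ([set n | s n = t] #= `I_d)%card.

Definition trace_class : set (H -> H) :=
  [set X | compact_op X /\ exists2 s, singular_numbers X s & cvgn (series s)].

Definition operator_ideal I :=
  [/\ I `<=` compact_op,
      exists2 X, I X & exists x, X x != 0,
      forall X Y, I X -> I Y -> I (X \+ Y),
      forall T X, bounded_op T -> I X -> I (T \o X)
    & forall T X, bounded_op T -> I X -> I (X \o T)].

Definition charset I : set (nat -> R) :=
  [set s | exists2 X, I X & singular_numbers X s].

(* The ideal with a prescribed characteristic set [S]. *)
Definition ideal_of (S : set (nat -> R)) : set (H -> H) :=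
  [set X | compact_op X /\ exists2 s, singular_numbers X s & S s].

Definition pre_am_oo I : set (H -> H) :=
  ideal_of [set xi | l1star xi /\ charset I (am_oo xi)].

Definition am_oo_ideal I : set (H -> H) :=
  ideal_of [set xi | c0star xi /\
    exists2 eta, charset (I `&` trace_class) eta & seqO xi (am_oo eta)].

Definition am_oo_closure I : set (H -> H) := pre_am_oo (am_oo_ideal I).

Definition diag_op e (rho : nat -> R[i]) : H -> H :=
  fun x => limn (series (fun n => (rho n * dot x (e n)) *: e n)).

Definition diagR_op e (rho : nat -> R) : H -> H :=
  diag_op e (fun n => (rho n)%:C).

Definition diag_expectation e T : H -> H :=
  diag_op e (fun n => dot (T (e n)) (e n)).

(* [T] is the operator identified with the infinite real matrix [U]. *)
Definition has_matrix e T (U : nat -> nat -> R) :=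
  bounded_op T /\ forall i j, dot (T (e j)) (e i) = (U i j)%:C.

End Operators.

(* Main.v *)
Require Import Defs.
From HB Require Import structures.
From mathcomp Require Import all_boot all_order all_algebra.
From mathcomp Require Import complex finmap.
From mathcomp Require Import all_classical all_reals all_analysis.
From mathcomp Require Import ring lra.

Set Implicit Arguments.
Unset Strict Implicit.
Unset Printing Implicit Defensive.

Import Order.TTheory GRing.Theory Num.Theory.
Import numFieldNormedType.Exports.

Local Open Scope classical_set_scope.
Local Open Scope ring_scope.
Local Open Scope complex_scope.

(* For a sequence [s], [s] is in the characteristic set of [I] iff [diag s] is
   in [I], and a column-stochastic [P] satisfies [sum_(i<n) (P xi)_i <=
   sum_(i<n) xi_i] with equal totals; passing to tails, every condition yields
   (ii).  For (iv), the diagonal [d = P xi] of [V (diag xi) V^*] need not be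
   monotone, but the singular numbers of [diag d] are [A d], where [A] collects
   the squared coordinates of the singular vectors, and [A P] is again
   stochastic on the support of [xi].

   Conversely, let the tails of [xi] be dominated by those of [eta].  Cutting N
   into blocks, each as short as possible subject to [2 eta] having at least the
   block sum of [xi], gives a monotone sequence [eta' <= 2 eta] that is
   majorized by [xi] in each block with equal block sums.  Horn's theorem in
   each block produces the direct sum of orthogonal matrices required by (iii')
   and (iv'), hence also by the weaker conditions.  Condition (i) says that the
   tails of [xi] are bounded by a multiple of those of some [eta], except for
   the tail starting at the first entry, which a finite-rank change of [eta]
   takes care of. *)

(** * Inner products and orthogonal series *)

(** The factor 2 makes the blocks finite, as a direct sum of finite matrices demands: where the tail
    of [xi] is positive, the tail of [2 eta] exceeds it strictly, so the block sums catch up after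
    finitely many terms. With [eta] alone the tails may agree and a block may never close. The ideal
    absorbs the factor. Monotonicity of [eta'] is essential because a characteristic set contains
    only nonincreasing sequences: [Q xi] itself has to be one, and no rearrangement is available
    afterwards. Since [Q xi] has the same total as [xi], it also replaces the original [eta] when
    (ii) is strengthened to (ii') and (ii''). The restriction to the support of [xi] comes from the
    kernel of [diag d]: the singular numbers of an operator of infinite rank contain no zero, so the
    singular vectors need not span, and the columns of [A] where [d] vanishes may have mass below 1.
    Such columns only meet rows of [P] that vanish on the support of [xi]. *)

Definition sqnormc {R : realType} (z : R[i]) : R := complex.Re z ^+ 2 + complex.Im z ^+ 2.

Lemma conjCR {R : realType} (a : R) : (a%:C)^*%R = a%:C.
Proof. exact: conjc_real. Qed.

Section InnerProduct.
Context {R : realType} {H : completeNormedModType R[i]}.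
Variable dot : {dot H for Num.conj}.
Hypothesis dot_norm : hilbert_norm dot.

(** Norms over [R[i]] take values in [R[i]]; [norm2] and [sqnormc] are real-valued substitutes to
    which the order and the series of [R] apply. *)
Definition norm2 (x : H) : R := complex.Re (dot x x).
Local Notation sqnorm := norm2.

Lemma sqnormc_ge0 (z : R[i]) : 0 <= sqnormc z.
Proof. by rewrite addr_ge0 ?sqr_ge0. Qed.

Lemma sqnormcE (z : R[i]) : (sqnormc z)%:C = z * z^*%R.
Proof. by rewrite /sqnormc add_Re2_Im2 normCK. Qed.

Lemma realcM (a b : R) : (a * b)%:C = a%:C * b%:C. Proof. exact: rmorphM. Qed.

Lemma realcD (a b : R) : (a + b)%:C = a%:C + b%:C. Proof. exact: rmorphD. Qed.

Lemma sqnormcJ (a : R[i]) : sqnormc (a^*%R) = sqnormc a.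
Proof. by case: a => a b; rewrite /sqnormc /= sqrrN. Qed.

Lemma sqnormcR (a : R) : sqnormc (a%:C) = a ^+ 2.
Proof. by rewrite /sqnormc /= expr0n addr0. Qed.

Lemma sqnormc_eq0 (z : R[i]) : (sqnormc z == 0) = (z == 0).
Proof. by rewrite -(inj_eq (@complexI R)) /sqnormc add_Re2_Im2 sqrf_eq0 normr_eq0. Qed.

Lemma dot_sqnorm x : dot x x = (sqnorm x)%:C.
Proof.
rewrite /norm2 -dot_norm RRe_real //; apply: ger0_real; exact: exprn_ge0.
Qed.

Lemma normr2_sqnorm x : `|x| ^+ 2 = (sqnorm x)%:C. Proof. by rewrite dot_norm dot_sqnorm. Qed.

Lemma sqnorm_ge0 x : 0 <= sqnorm x.
Proof. by rewrite -ler0c -normr2_sqnorm exprn_ge0. Qed.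

Lemma sqnorm_eq0 x : sqnorm x = 0 -> x = 0.
Proof.
by move=> h; apply/eqP; rewrite -normr_eq0 -sqrf_eq0 normr2_sqnorm h.
Qed.

Lemma dotC x y : dot y x = (dot x y)^*%R.
Proof. by rewrite hermC /= expr0 mul1r. Qed.

Lemma sqnormZ a x : sqnorm (a *: x) = sqnormc a * sqnorm x.
Proof.
apply: complexI; rewrite -dot_sqnorm linearZl_LR linearZr_LR /= dot_sqnorm realcM sqnormcE.
by rewrite mulrA.
Qed.

Lemma dot_eq0C x y : dot x y = 0 -> dot y x = 0.
Proof. by move=> h; rewrite dotC h rmorph0. Qed.

Lemma sqnormD x y : dot x y = 0 -> sqnorm (x + y) = sqnorm x + sqnorm y.
Proof.
move=> h; rewrite /norm2 linearDl/= !linearDr /= h (dot_eq0C h) addr0 add0r.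
by case: (dot x x) (dot y y) => ? ? [].
Qed.

Lemma sqnormB x y : sqnorm (x - y) = sqnorm x + sqnorm y - 2 * complex.Re (dot x y).
Proof.
rewrite /norm2 linearBl/= !linearBr /= (dotC x y).
case: (dot x x) (dot y y) (dot x y) => ? ? [] ? ? [] ? ? /=; ring.
Qed.

Lemma cauchy_schwarz x y : sqnormc (dot x y) <= sqnorm x * sqnorm y.
Proof.
have [y0|yn0] := eqVneq y 0.
  by rewrite y0 linear0r /sqnormc /= /norm2 linear0r /= !expr0n /= mulr0 addr0.
have ny : 0 < sqnorm y.
  by rewrite lt_def sqnorm_ge0 andbT; apply: contra_neq yn0; exact: sqnorm_eq0.
(* The squared norm of [|y|^2 x - <x,y> y] is [|y|^2] times the difference of the two sides. *)
have := sqnorm_ge0 (((sqnorm y)%:C) *: x - dot x y *: y).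
rewrite sqnormB !sqnormZ linearZl_LR linearZr_LR /= sqnormcR.
have -> : complex.Re ((sqnorm y)%:C * ((dot x y)^*%R * dot x y)) = sqnorm y * sqnormc (dot x y).
  by rewrite [_^*%R * _]mulrC -sqnormcE -realcM.
move=> h.
have {}h : 0 <= sqnorm y * (sqnorm x * sqnorm y - sqnormc (dot x y)).
  by move: h; congr (_ <= _); ring.
by rewrite pmulr_rge0 // subr_ge0 in h.
Qed.

Lemma sqnorm_sum (u : nat -> H) n : (forall i j, i != j -> dot (u i) (u j) = 0) ->
  sqnorm (\sum_(i < n) u i) = \sum_(i < n) sqnorm (u i).
Proof.
move=> ou; elim: n => [|n IH]; first by rewrite !big_ord0 /norm2 linear0r.
rewrite !big_ord_recr /= sqnormD ?IH // linear_sumlz.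
rewrite big1 // => i _; apply: ou; by rewrite ltn_eqF.
Qed.

End InnerProduct.

Section Convergence.
Context {R : realType} {H : completeNormedModType R[i]}.
Variable dot : {dot H for Num.conj}.
Hypothesis dot_norm : hilbert_norm dot.
Local Notation sqnorm := (norm2 dot).

Lemma normr_sqnorm x : `|x| = (Num.sqrt (sqnorm x))%:C.
Proof.
have := normr2_sqnorm dot_norm x.
rewrite -(@sqr_sqrtr _ (sqnorm x)) ?sqnorm_ge0 // expr2 realcM -!expr2 => /eqP.
rewrite sqr_sqrtr ?sqnorm_ge0 //.
by rewrite eqrXn2 // ?ler0c ?sqrtr_ge0 // => /eqP.
Qed.

Lemma sqnormN x : sqnorm (- x) = sqnorm x.
Proof. by rewrite /norm2 linearNl/= linearNr /= opprK. Qed.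

Lemma cvg_sqnormP (u : nat -> H) (x : H) :
  u @ \oo --> x <-> (fun n => sqnorm (u n - x)) @ \oo --> (0 : R).
Proof.
split=> [ux|ux].
  apply/cvgrPdist_lt => e e0; move/cvgrPdist_lt : ux => /(_ (Num.sqrt e)%:C).
  rewrite ltcR sqrtr_gt0 => /(_ e0); apply: filterS => n.
  rewrite normr_sqnorm ltcR ltr_sqrt // -sqnormN opprB.
  by rewrite sub0r normrN ger0_norm // sqnorm_ge0.
apply/cvgrPdist_lt => e e0.
have eE : e = (complex.Re e)%:C by rewrite RRe_real // gtr0_real.
have r0 : 0 < complex.Re e by rewrite eE ltcR in e0.
move/cvgrPdist_lt : ux => /(_ (complex.Re e ^+ 2)); rewrite exprn_gt0 // => /(_ isT).
apply: filterS => n; rewrite sub0r normrN ger0_norm ?sqnorm_ge0 // => h.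
rewrite normr_sqnorm eE ltcR -[ltRHS]ger0_norm ?ltW// -sqrtr_sqr ltr_sqrt ?exprn_gt0 //.
by rewrite -opprB sqnormN.
Qed.

Lemma cvg_sqnorm (u : nat -> H) (x : H) :
  u @ \oo --> x -> (fun n => sqnorm (u n)) @ \oo --> sqnorm x.
Proof.
move=> ux.
suff h : (fun n => Num.sqrt (sqnorm (u n))) @ \oo --> Num.sqrt (sqnorm x).
  rewrite -[X in _ --> X]sqr_sqrtr ?sqnorm_ge0 // expr2.
  rewrite (_ : (fun n => _) = (fun n => Num.sqrt (sqnorm (u n)) * Num.sqrt (sqnorm (u n)))).
    exact: cvgM.
  by apply/funext => n; rewrite -expr2 sqr_sqrtr ?sqnorm_ge0.
apply/cvgrPdist_lt => e e0; move/cvgrPdist_lt : ux => /(_ e%:C).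
rewrite ltcR => /(_ e0); apply: filterS => n /=.
move=> h; rewrite -ltcR (le_lt_trans _ h) //.
have := ler_dist_dist x (u n); rewrite !normr_sqnorm -rmorphB /=.
by rewrite normc_def /= expr0n addr0 sqrtr_sqr.
Qed.

Lemma cvg_dot (u : nat -> H) (x y : H) :
  u @ \oo --> x -> (fun n => sqnormc (dot (u n) y - dot x y)) @ \oo --> (0 : R).
Proof.
move/cvg_sqnormP => ux.
apply: (@squeeze_cvgr _ _ _ _ (fun=> 0) (fun n => sqnorm (u n - x) * sqnorm y)).
- by near=> n; rewrite sqnormc_ge0 -linearBl /= cauchy_schwarz.
- exact: cvg_cst.
- by rewrite -[X in _ --> X](mul0r (sqnorm y)); apply: cvgM => //; exact: cvg_cst.
Unshelve. all: by end_near. Qed.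

Lemma dot_lim (u : nat -> H) (x y : H) (c : R[i]) : u @ \oo --> x ->
  (\forall n \near \oo, dot (u n) y = c) -> dot x y = c.
Proof.
move=> ux uc; have h := cvg_dot y ux.
have : (fun n => sqnormc (dot (u n) y - dot x y)) @ \oo --> sqnormc (c - dot x y).
  apply: cvg_near_cst; apply: filterS uc => n ->//.
move=> h'; have : sqnormc (c - dot x y) = 0 by exact: cvg_unique h' h.
by move/eqP; rewrite sqnormc_eq0 subr_eq0 => /eqP.
Qed.

Lemma sqnorm_sum_nat (u : nat -> H) m n : (forall i j, i != j -> dot (u i) (u j) = 0) ->
  sqnorm (\sum_(m <= i < n) u i) = \sum_(m <= i < n) sqnorm (u i).
Proof.
move=> ou; rewrite -(add0n m) !big_addn !big_mkord.
apply: (@sqnorm_sum _ _ _ (fun i => u (i + m)%N)) => i j ij.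
by apply: ou; rewrite eqn_add2r.
Qed.

(** By Pythagoras the Cauchy criterion for [series u] is that for the bounded, hence convergent,
    series of squared norms; [H] is complete. *)
Lemma orthogonal_series_cvg (u : nat -> H) (M : R) :
  (forall i j, i != j -> dot (u i) (u j) = 0) ->
  (forall n, \sum_(0 <= i < n) sqnorm (u i) <= M) -> cvgn (series u).
Proof.
move=> ou uM.
have cu : cvgn (series (fun i => sqnorm (u i))).
  apply: nondecreasing_is_cvgn.
    by apply: nondecreasing_series => n _ _; exact: sqnorm_ge0.
  by exists M => _ [n _ <-]; exact: uM.
apply/cauchy_cvgP/cauchy_seriesP => e e0.
have eE : e = (complex.Re e)%:C by rewrite RRe_real // gtr0_real.
have r0 : 0 < complex.Re e by rewrite eE ltcR in e0.
move/cauchy_cvgP/cauchy_seriesP : cu => /(_ (complex.Re e ^+ 2)).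
rewrite exprn_gt0 // => /(_ isT); apply: filterS => n.
rewrite ger0_norm ?sumr_ge0 // => [h|i _]; last exact: sqnorm_ge0.
rewrite normr_sqnorm eE ltcR -[ltRHS]ger0_norm ?ltW// -sqrtr_sqr ltr_sqrt ?exprn_gt0 //.
by rewrite sqnorm_sum_nat.
Qed.

Lemma sqnorm_series_lim (u : nat -> H) (x : H) :
  (forall i j, i != j -> dot (u i) (u j) = 0) -> series u @ \oo --> x ->
  series (fun i => sqnorm (u i)) @ \oo --> sqnorm x.
Proof.
move=> ou /cvg_sqnorm; apply: cvg_trans; apply: near_eq_cvg.
by near=> n; rewrite /series /= sqnorm_sum_nat.
Unshelve. all: by end_near. Qed.

(** The bridge between the real limits in [mxseq] and the extended real sums in [column_stochastic],
    where sums can be interchanged freely. *)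
Lemma nneseries_lim_fin (a : nat -> R) (l : R) : (forall n, 0 <= a n) ->
  series a @ \oo --> l -> (\sum_(n <oo) (a n)%:E = l%:E)%E.
Proof.
move=> a0 al; apply/cvg_lim => //.
rewrite (_ : (fun n => _) = EFin \o series a); last first.
  by apply/funext => n /=; rewrite sumEFin.
by apply: cvg_EFin => //; near=> n.
Unshelve. all: by end_near. Qed.

End Convergence.

(** * Bounded operators and adjoints *)

Section Operators.
Context {R : realType} {H : completeNormedModType R[i]}.
Variable dot : {dot H for Num.conj}.
Hypothesis dot_norm : hilbert_norm dot.
Local Notation sqnorm := (norm2 dot).
Implicit Types (T S : H -> H) (x y : H).

Let pack_linear T (lT : linear T) : {linear H -> H}
 := HB.pack T (GRing.isLinear.Build _ _ _ _ _ lT).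

Lemma linear_sub T : linear T -> forall x y, T (x - y) = T x - T y.
Proof. by move=> lT x y; exact: (linearB (pack_linear lT)). Qed.

Lemma linear_scale T : linear T -> forall a x, T (a *: x) = a *: T x.
Proof. by move=> lT a x; exact: (linearZ_LR (pack_linear lT)). Qed.

Lemma linear_sum_nat T : linear T -> forall m n (u : nat -> H),
  T (\sum_(m <= i < n) u i) = \sum_(m <= i < n) T (u i).
Proof. by move=> lT m n u; exact: (linear_sum (pack_linear lT)). Qed.

Lemma bounded_opP T :
  bounded_op T <-> linear T /\ exists2 M : R, 0 <= M & forall x, sqnorm (T x) <= M * sqnorm x.
Proof.
split=> [[lT cT]|[lT [M M0 TM]]].
  split=> //.
  have /linear_boundedP := @continuous_linear_bounded _ _ _ 0 (pack_linear lT) (cT 0).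
  move=> /pinfty_ex_gt0 [M M0 TM].
  have ME : M = (complex.Re M)%:C by rewrite RRe_real // gtr0_real.
  have r0 : 0 < complex.Re M by rewrite ME ltcR in M0.
  exists (complex.Re M ^+ 2) => [|x]; first exact: sqr_ge0.
  rewrite -lecR realcM -!(normr2_sqnorm dot_norm) [(complex.Re M ^+ 2)%:C]rmorphXn /=.
  by rewrite -ME -exprMn lerXn2r ?nnegrE // ?mulr_ge0 // ltW.
split=> //; apply: (@bounded_linear_continuous _ _ _ (pack_linear lT)).
apply/linear_boundedP; near=> r => x /=.
apply: (@le_trans _ _ ((Num.sqrt M)%:C * `|x|)); last first.
  rewrite ler_wpM2r //; near: r; apply: nbhs_pinfty_ge; apply/complex_realP.
  by eexists.
by rewrite !(normr_sqnorm dot_norm) -realcM lecR -sqrtrM // ler_wsqrtr.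
Unshelve. all: by end_near. Qed.

Lemma bounded_op_linear T : bounded_op T -> linear T. Proof. by case. Qed.

Lemma bounded_op_comp T S : bounded_op T -> bounded_op S -> bounded_op (T \o S).
Proof.
move=> [lT cT] [lS cS]; split; first by move=> a x y /=; rewrite lS lT.
by move=> x; apply: continuous_comp; [exact: cS|exact: cT].
Qed.

Lemma bounded_op_cvg T (u : nat -> H) x : bounded_op T ->
  u @ \oo --> x -> (fun n => T (u n)) @ \oo --> T x.
Proof. by move=> [_ cT] ux; apply: (cvg_comp _ _ ux); exact: cT. Qed.

Variable e : nat -> H.
Hypothesis e_basis : orthonormal_basis dot e.

Lemma basis_coord_inj x y : (forall n, dot x (e n) = dot y (e n)) -> x = y.
Proof.
move=> xy; have h := e_basis.2 y; have := e_basis.2 x.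
have -> : (fun n => dot x (e n) *: e n) = (fun n => dot y (e n) *: e n).
  by apply/funext => n; rewrite xy.
by move/cvg_unique; apply => //; exact: norm_hausdorff.
Qed.

Lemma basis_sqnorm n : sqnorm (e n) = 1.
Proof. by rewrite /norm2 e_basis.1 eqxx. Qed.

Lemma basis_orth i j : i != j -> dot (e i) (e j) = 0.
Proof. by rewrite e_basis.1 => /negbTE->. Qed.

Lemma orth_scale (a : nat -> R[i]) (u : nat -> H) :
  (forall i j, i != j -> dot (u i) (u j) = 0) ->
  forall i j, i != j -> dot (a i *: u i) (a j *: u j) = 0.
Proof. by move=> ou i j ij; rewrite linearZl_LR linearZr_LR /= ou // !mulr0. Qed.

Lemma parseval_cvg x : series (fun n => sqnormc (dot x (e n))) @ \oo --> sqnorm x.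
Proof.
have -> : (fun n => sqnormc (dot x (e n))) = fun n => sqnorm (dot x (e n) *: e n).
  by apply/funext => n; rewrite sqnormZ // basis_sqnorm mulr1.
exact: (sqnorm_series_lim dot_norm (orth_scale _ basis_orth) (e_basis.2 x)).
Qed.

Lemma parseval x : (\sum_(n <oo) (sqnormc (dot x (e n)))%:E = (sqnorm x)%:E)%E.
Proof. by apply: nneseries_lim_fin; [move=> n; exact: sqnormc_ge0|exact: parseval_cvg]. Qed.

Lemma parseval_le x n : \sum_(0 <= i < n) sqnormc (dot x (e i)) <= sqnorm x.
Proof.
rewrite -(cvg_lim _ (@parseval_cvg x)) //.
apply: nondecreasing_cvgn_le; last by apply/cvg_ex; eexists; exact: parseval_cvg.
by apply: nondecreasing_series => k _ _; exact: sqnormc_ge0.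
Qed.

(** The operator with [e n] sent to [u n], bounded when [u] is orthogonal and bounded. Diagonal
    operators, operators of rank one, partial isometries and the isometry with a prescribed matrix
    all arise in this way. *)
Definition synth (u : nat -> H) : H -> H :=
  fun x => limn (series (fun n => dot x (e n) *: u n)).

Section Synthesis.
Variables (u : nat -> H) (M : R).
Hypotheses (u_orth : forall i j, i != j -> dot (u i) (u j) = 0)
  (u_bounded : forall n, sqnorm (u n) <= M).

Let M_ge0 : 0 <= M. Proof. exact: le_trans (sqnorm_ge0 dot_norm (u 0%N)) (u_bounded _). Qed.

Lemma synth_cvg x : series (fun n => dot x (e n) *: u n) @ \oo --> synth u x.
Proof.
have h : cvgn (series (fun n => dot x (e n) *: u n)).
  apply: (@orthogonal_series_cvg _ _ _ dot_norm _ (M * sqnorm x)).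
    exact: orth_scale.
  move=> n; apply: le_trans (ler_wpM2l M_ge0 (parseval_le x n)).
  rewrite mulr_sumr; apply: ler_sum => i _; rewrite sqnormZ // mulrC.
  by rewrite ler_wpM2r ?sqnormc_ge0.
exact: h.
Qed.

Lemma synth_linear : linear (synth u).
Proof.
move=> a x y; apply: cvg_lim; first exact: norm_hausdorff.
have -> : series (fun n => dot (a *: x + y) (e n) *: u n) =
  (fun n => a *: series (fun n => dot x (e n) *: u n) n
     + series (fun n => dot y (e n) *: u n) n).
  apply/funext => n; rewrite /series /= scaler_sumr -big_split /=.
  by apply: eq_bigr => i _; rewrite linearPl /= scalerDl scalerA.
by apply: cvgD; [apply: cvgZr|]; exact: synth_cvg.
Qed.

Lemma sqnorm_synth_cvg x :
  series (fun n => sqnormc (dot x (e n)) * sqnorm (u n)) @ \oo --> sqnorm (synth u x).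
Proof.
have -> : (fun n => sqnormc (dot x (e n)) * sqnorm (u n)) =
    fun n => sqnorm (dot x (e n) *: u n).
  by apply/funext => n; rewrite sqnormZ.
exact: (sqnorm_series_lim dot_norm (orth_scale _ u_orth) (@synth_cvg x)).
Qed.

Lemma sqnorm_synth_le x : sqnorm (synth u x) <= M * sqnorm x.
Proof.
have h := @sqnorm_synth_cvg x; rewrite -(cvg_lim _ h) //.
apply: limr_le; first by apply/cvg_ex; eexists; exact: h.
near=> n; rewrite /series /=.
apply: le_trans (ler_wpM2l M_ge0 (parseval_le x n)).
rewrite mulr_sumr; apply: ler_sum => i _; rewrite mulrC.
by rewrite ler_wpM2r ?sqnormc_ge0.
Unshelve. all: by end_near. Qed.

Lemma synth_bounded : bounded_op (synth u).
Proof.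
apply/bounded_opP; split; first exact: synth_linear.
by exists M => // x; exact: sqnorm_synth_le.
Qed.

Lemma synth_basis n : synth u (e n) = u n.
Proof.
apply: cvg_lim; first exact: norm_hausdorff.
apply: cvg_near_cst; near=> m.
rewrite /series /= (bigD1_seq n) /= ?iota_uniq // ?mem_index_iota /=; last by near: m; exists n.+1.
rewrite e_basis.1 eqxx scale1r big1 ?addr0 // => i /negbTE ni.
by rewrite e_basis.1 eq_sym ni scale0r.
Unshelve. all: by end_near. Qed.

End Synthesis.

Lemma bounded_op_expand T x : bounded_op T ->
  series (fun n => dot x (e n) *: T (e n)) @ \oo --> T x.
Proof.
move=> bT.
suff -> : series (fun n => dot x (e n) *: T (e n)) =
    fun n => T (series (fun n => dot x (e n) *: e n) n).
  exact: bounded_op_cvg (e_basis.2 x).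
apply/funext => n; rewrite /series /= linear_sum_nat //; last exact: bounded_op_linear.
by apply: eq_bigr => i _; rewrite linear_scale //; exact: bounded_op_linear.
Qed.

Lemma bounded_op_eq T S : bounded_op T -> bounded_op S ->
  (forall n, T (e n) = S (e n)) -> T = S.
Proof.
move=> bT bS TS; apply/funext => x.
have h := @bounded_op_expand S x bS; have := @bounded_op_expand T x bT.
have -> : (fun n => dot x (e n) *: T (e n)) = (fun n => dot x (e n) *: S (e n)).
  by apply/funext => n; rewrite TS.
by move/cvg_unique; apply => //; exact: norm_hausdorff.
Qed.

End Operators.
Arguments bounded_op_expand {R H dot e} e_basis {T} x bT.
Arguments parseval_cvg {R H dot} dot_norm {e} e_basis x.
Arguments synth_cvg {R H dot} dot_norm {e} e_basis {u M} u_orth u_bounded x.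
Arguments sqnorm_synth_cvg {R H dot} dot_norm {e} e_basis {u M} u_orth u_bounded x.

(** * Adjoints and diagonal operators *)

Section Adjoints.
Context {R : realType} {H : completeNormedModType R[i]}.
Variable dot : {dot H for Num.conj}.
Hypothesis dot_norm : hilbert_norm dot.
Local Notation sqnorm := (norm2 dot).
Implicit Types (T S : H -> H) (x y : H).
Variable e : nat -> H.
Hypothesis e_basis : orthonormal_basis dot e.

Lemma sqnormc_lim_uniq (a : nat -> R[i]) (b c : R[i]) :
  (fun n => sqnormc (a n - b)) @ \oo --> (0 : R) ->
  (fun n => sqnormc (a n - c)) @ \oo --> (0 : R) -> b = c.
Proof.
move=> hb hc; apply/eqP; rewrite -subr_eq0 -sqnormc_eq0 eq_le sqnormc_ge0 andbT.
have h : (fun n => 2 * (sqnormc (a n - b) + sqnormc (a n - c))) @ \oo --> (2 * (0 + 0) : R).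
  by apply: cvgM; [exact: cvg_cst|exact: cvgD].
rewrite addr0 mulr0 in h; apply: (cvgr_to_ge h).
near=> n; move: (a n) b c {hb hc h} => [a1 a2] [b1 b2] [c1 c2]; rewrite /sqnormc /=.
rewrite -subr_ge0; set X := (X in 0 <= X).
(* Parallelogram law: the difference is the squared modulus of [(a - b) + (a - c)]. *)
have -> : X = (2 * a1 - b1 - c1) ^+ 2 + (2 * a2 - b2 - c2) ^+ 2 by rewrite /X; ring.
by rewrite addr_ge0 ?sqr_ge0.
Unshelve. all: by end_near. Qed.

Lemma dot_lim_eq (u v : nat -> H) x x' y y' : u @ \oo --> x -> v @ \oo --> x' ->
  (forall n, dot (u n) y = dot (v n) y') -> dot x y = dot x' y'.
Proof.
move=> ux vx uv; apply: (sqnormc_lim_uniq (cvg_dot dot_norm y ux)).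
under eq_fun do rewrite uv.
exact: cvg_dot.
Qed.

Lemma dot_eqR x y : (forall z, dot z x = dot z y) -> x = y.
Proof.
move=> h; apply/eqP; rewrite -subr_eq0; apply/eqP/(sqnorm_eq0 dot_norm).
by rewrite /norm2 linearBr /= h subrr.
Qed.

(** [adjoint] is a choice among candidates, so existence has to be shown. This is Riesz
    representation in coordinates: the vector sought has coordinates [c n]. For a partial sum [z] of
    its expansion, [<T z, y> = |z|^2], and Cauchy-Schwarz bounds [|z|^2] by [M |y|^2]. *)
Lemma adjoint_exists T : bounded_op T -> exists S, forall x y, dot (T x) y = dot x (S y).
Proof.
move=> bT; have /(bounded_opP dot_norm) [lT [M M0 TM]] := bT.
suff h y : exists z, forall x, dot (T x) y = dot x z.
  by exists (fun y => sval (cid (h y))) => x y; exact: (svalP (cid (h y))).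
pose c n := dot y (T (e n)).
have cM n : \sum_(0 <= i < n) sqnorm (c i *: e i) <= M * sqnorm y.
  pose z := \sum_(0 <= i < n) c i *: e i.
  have zE : sqnorm z = \sum_(0 <= i < n) sqnorm (c i *: e i).
    by rewrite sqnorm_sum_nat //; apply: orth_scale; exact: (basis_orth e_basis).
  rewrite -zE; have [->|z0] := eqVneq (sqnorm z) 0; first by rewrite mulr_ge0 ?sqnorm_ge0.
  have {}z0 : 0 < sqnorm z by rewrite lt_def z0 sqnorm_ge0.
  have TzE : dot (T z) y = (sqnorm z)%:C.
    rewrite zE linear_sum_nat // linear_sumlz rmorph_sum /=; apply: eq_bigr => i _.
    rewrite linear_scale // linearZl_LR sqnormZ // (basis_sqnorm e_basis) mulr1 sqnormcE /=.
    by rewrite -dotC.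
  have := cauchy_schwarz dot_norm (T z) y; rewrite TzE sqnormcR => hz.
  have : sqnorm z ^+ 2 <= M * sqnorm z * sqnorm y.
    by apply: le_trans hz _; rewrite ler_wpM2r ?sqnorm_ge0.
  by rewrite expr2 -mulrA mulrCA ler_pM2l.
have /orthogonal_series_cvg := cM => /(_ dot_norm) /(_ _)/cvg_ex [|z cz].
  by apply: orth_scale; exact: (basis_orth e_basis).
exists z => x.
have cn n : dot (e n) z = dot (T (e n)) y.
  rewrite [RHS]dotC [LHS]dotC; congr (_^*%R); apply: dot_lim cz _ => //.
  near=> m; rewrite /series /= linear_sumlz.
  rewrite (bigD1_seq n) /= ?iota_uniq // ?mem_index_iota /=; last by near: m; exists n.+1.
  rewrite linearZl_LR /= e_basis.1 eqxx mulr1 big1 ?addr0 // => i /negbTE ni.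
  by rewrite linearZl_LR /= e_basis.1 ni mulr0.
apply: (dot_lim_eq (bounded_op_expand e_basis x bT) (e_basis.2 x)) => n.
rewrite /series /= !linear_sumlz; apply: eq_bigr => i _.
by rewrite !linearZl_LR /= cn.
Unshelve. all: by end_near. Qed.

Lemma adjointP T : bounded_op T -> forall x y, dot (T x) y = dot x (adjoint dot T y).
Proof.
move=> /adjoint_exists exS.
exact: (@xgetPex _ (fun=> 0) [set S | forall x y, dot (T x) y = dot x (S y)]).
Qed.

(** For [z] the image of [y] under the adjoint, [|z|^2 = <T z, y>]; Cauchy-Schwarz and division by
    [|z|^2] give the bound. *)
Lemma sqnorm_adjoint_le T M : bounded_op T -> 0 <= M ->
  (forall x, sqnorm (T x) <= M * sqnorm x) ->
  forall y, sqnorm (adjoint dot T y) <= M * sqnorm y.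
Proof.
move=> bT M0 TM y; set z := adjoint dot T y.
have [->|z0] := eqVneq (sqnorm z) 0; first by rewrite mulr_ge0 ?sqnorm_ge0.
have {}z0 : 0 < sqnorm z by rewrite lt_def z0 sqnorm_ge0.
have := cauchy_schwarz dot_norm (T z) y.
rewrite (adjointP bT) -/z (dot_sqnorm dot_norm) sqnormcR => hz.
have : sqnorm z ^+ 2 <= M * sqnorm z * sqnorm y.
  by apply: le_trans hz _; rewrite ler_wpM2r ?sqnorm_ge0.
by rewrite expr2 -mulrA mulrCA ler_pM2l.
Qed.

Lemma adjoint_bounded T : bounded_op T -> bounded_op (adjoint dot T).
Proof.
move=> bT; have aP := adjointP bT; have /(bounded_opP dot_norm) [lT [M M0 TM]] := bT.
apply/(bounded_opP dot_norm); split=> [a x y|].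
  by apply: dot_eqR => z; rewrite -aP !linearDr !linearZr_LR /= -!aP.
by exists M => //; exact: sqnorm_adjoint_le.
Qed.

Lemma adjoint_eq T S : bounded_op T -> bounded_op S ->
  (forall m n, dot (T (e m)) (e n) = dot (e m) (S (e n))) -> adjoint dot T = S.
Proof.
move=> bT bS TS; apply: (bounded_op_eq e_basis) => //; first exact: adjoint_bounded.
move=> n; apply: (basis_coord_inj e_basis) => m.
by rewrite dotC -adjointP // TS -dotC.
Qed.

Lemma diag_opE rho : diag_op dot e rho = synth dot e (fun n => rho n *: e n).
Proof.
apply/funext => x; rewrite /diag_op /synth; congr (limn (series _)).
by apply/funext => n; rewrite scalerA mulrC.
Qed.

Section Diagonal.
Variables (rho : nat -> R[i]) (M : R).
Hypothesis rhoM : forall n, sqnormc (rho n) <= M.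

Let orth i j : i != j -> dot (rho i *: e i) (rho j *: e j) = 0.
Proof. by apply: orth_scale; exact: (basis_orth e_basis). Qed.

Let bounded n : sqnorm (rho n *: e n) <= M.
Proof. by rewrite sqnormZ // (basis_sqnorm e_basis) mulr1. Qed.

Lemma diag_bounded : bounded_op (diag_op dot e rho).
Proof. by rewrite diag_opE; exact: synth_bounded orth bounded. Qed.

Lemma sqnorm_diag_le x : sqnorm (diag_op dot e rho x) <= M * sqnorm x.
Proof. by rewrite diag_opE; exact: sqnorm_synth_le orth bounded x. Qed.

Lemma diag_basis n : diag_op dot e rho (e n) = rho n *: e n.
Proof. by rewrite diag_opE (synth_basis e_basis). Qed.

Lemma diag_coord x n : dot (diag_op dot e rho x) (e n) = rho n * dot x (e n).
Proof.
rewrite diag_opE; apply: (dot_lim dot_norm (synth_cvg dot_norm e_basis orth bounded x)).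
near=> m; rewrite /series /= linear_sumlz.
rewrite (bigD1_seq n) /= ?iota_uniq // ?mem_index_iota /=; last by near: m; exists n.+1.
rewrite !linearZl_LR /= e_basis.1 eqxx mulr1 mulrC big1 ?addr0 // => i /negbTE ni.
by rewrite !linearZl_LR /= e_basis.1 ni !mulr0.
Unshelve. all: by end_near. Qed.

End Diagonal.

Lemma adjoint_diagR (rho : nat -> R) (M : R) : (forall n, sqnormc ((rho n)%:C) <= M) ->
  adjoint dot (diagR_op dot e rho) = diagR_op dot e rho.
Proof.
move=> rM; apply: adjoint_eq; try exact: diag_bounded rM.
move=> m n; rewrite (diag_coord rM) /diagR_op diag_basis linearZr_LR /= e_basis.1.
by congr (_ * _); rewrite -[LHS](conjc_real (rho n)).
Qed.

End Adjoints.

(** * Norm limits of compact operators *)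

Section Compactness.
Context {R : realType} {H : completeNormedModType R[i]}.

(* An ultrafilter on [closure (T B)] is pulled back to the unit ball [B] up to
   [eps] and pushed forward by a compact [eps]-approximation of [T], where it
   converges; hence it is Cauchy. *)
Lemma compact_op_approx (T : H -> H) : bounded_op T ->
  (forall eps : R[i], 0 < eps -> exists2 S, compact_op S &
     forall x, `|x| <= 1 -> `|T x - S x| <= eps) ->
  compact_op T.
Proof.
move=> bT apx; split=> //.
rewrite compact_ultra => F FU FTB.
have FF : ProperFilter F by exact: ultra_proper.
have cF : cauchy F.
  apply: cauchy_exP => eps eps0.
  have e3 : 0 < eps / 4 by rewrite divr_gt0.
  have [S [bS cS] TS] := apx _ e3.
  have gP y : exists x, closure (T @` [set x | `|x| <= 1]) y ->
      `|x| <= 1 /\ `|y - T x| < eps / 4.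
    have [cy|ncy] := pselect (closure (T @` [set x | `|x| <= 1]) y); last by exists 0.
    have [|_ [[x x1 <-]]] := cy (ball y (eps / 4)); first exact: nbhsx_ballx.
    by rewrite -ball_normE /= => h; exists x.
  pose g y := sval (cid (gP y)).
  have gQ y : closure (T @` [set x | `|x| <= 1]) y ->
      `|g y| <= 1 /\ `|y - T (g y)| < eps / 4 by exact: (svalP (cid (gP y))).
  have [|p [_ Gp]] := cS ((fun y => S (g y)) @ F).
    rewrite /nbhs/=; apply: filterS FTB => y /gQ [gy _] /=.
    by apply: subset_closure; exists (g y).
  exists p; pose A := [set y | ball p (eps / 4) (S (g y))].
  have FA : F A.
    have [//|FnA] := in_ultra_setVsetC A FU.
    by have [z [nz /nz]] := Gp (~` ball p (eps / 4)) _ FnA (nbhsx_ballx p _ e3).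
  apply: filterS2 FA FTB => y; rewrite /A /=.
  rewrite -!ball_normE /= => py /gQ [g1 Tg].
  have -> : p - y = (p - S (g y)) - (T (g y) - S (g y)) - (y - T (g y)).
    by rewrite !opprB !subrKA.
  apply: le_lt_trans (ler_normB _ _) _.
  have -> : eps = (eps / 4 + eps / 4) + (eps / 4 + eps / 4) by field.
  apply: ltrD; last by apply: lt_trans Tg _; rewrite ltrDl.
  apply: le_lt_trans (ler_normB _ _) _; rewrite ltr_leD //; exact: TS.
have /cauchy_cvgP cvF := cF.
exists (lim F); split=> //.
by apply: (closed_cvg _ (@closed_closure _ _) FTB).
Qed.

End Compactness.

(** * Singular numbers *)

Section Dimension.
Context {R : realType} {H : completeNormedModType R[i]}.
Variable dot : {dot H for Num.conj}.
Hypothesis dot_norm : hilbert_norm dot.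
Local Notation sqnorm := (norm2 dot).

(** The transition matrices between the two bases have product the identity of size [d'], which
    cannot factor through a smaller dimension. *)
Lemma has_dim_le (W : set H) d d' : has_dim W d -> has_dim W d' -> (d' <= d)%N.
Proof.
move=> [v [vi vW]] [v' [vi' vW']].
have mem k : W (v' k).
  apply/vW'; exists (delta_mx 0 k); rewrite (bigD1 k) //= mxE !eqxx scale1r big1 ?addr0 //.
  by move=> i /negbTE ik; rewrite mxE ik andbF scale0r.
have mem0 k : W (v k).
  apply/vW; exists (delta_mx 0 k); rewrite (bigD1 k) //= mxE !eqxx scale1r big1 ?addr0 //.
  by move=> i /negbTE ik; rewrite mxE ik andbF scale0r.
have [C CE] := choice (fun k => (vW _).1 (mem k)).
have [D DE] := choice (fun k => (vW' _).1 (mem0 k)).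
pose MC := \matrix_(k, j) C k 0 j; pose MD := \matrix_(k, j) D k 0 j.
apply: (@mulmx1_min _ _ _ MC MD); apply/eqP; rewrite -subr_eq0; apply/eqP/row_matrixP => k.
rewrite row0; apply: vi'.
under eq_bigr do rewrite !mxE scalerBl scaler_suml.
rewrite sumrB exchange_big /=.
have -> : \sum_(i < d') (k == i)%:R *: v' i = v' k.
  rewrite (bigD1 k) //= eqxx scale1r big1 ?addr0 // => i /negbTE.
  by rewrite eq_sym => ->; rewrite scale0r.
apply/eqP; rewrite subr_eq0; apply/eqP; rewrite [RHS]CE.
apply: eq_bigr => j _; rewrite [v j in RHS]DE scaler_sumr; apply: eq_bigr => i _.
by rewrite !mxE scalerA.
Qed.

Lemma has_dim_uniq (W : set H) d d' : has_dim W d -> has_dim W d' -> d = d'.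
Proof.
by move=> h h'; apply/eqP; rewrite eqn_leq (has_dim_le h h') (has_dim_le h' h).
Qed.

(** Families indexed by [nat] and cut off at [d] can be extended in an induction on [d] without
    casts between ordinals. *)
Definition spanned (v : nat -> H) (d : nat) : set H :=
  [set x | exists a : nat -> R[i], x = \sum_(0 <= i < d) a i *: v i].

Lemma spanned_lin v d a x y : spanned v d x -> spanned v d y -> spanned v d (a *: x + y).
Proof.
move=> [b ->] [c ->]; exists (fun i => a * b i + c i).
by rewrite scaler_sumr -big_split; apply: eq_bigr => i _; rewrite scalerDl scalerA.
Qed.

Lemma spanned0 v d : spanned v d 0.
Proof. by exists (fun=> 0); rewrite big1 // => i _; rewrite scale0r. Qed.

Lemma spanned_scale v d a x : spanned v d x -> spanned v d (a *: x).
Proof. by move=> sx; rewrite -[_ *: _]addr0; apply: spanned_lin => //; exact: spanned0. Qed.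

Lemma spanned_sum v d n (a : nat -> R[i]) (u : nat -> H) :
  (forall i, (i < n)%N -> spanned v d (u i)) ->
  spanned v d (\sum_(0 <= i < n) a i *: u i).
Proof.
elim: n => [|n IH] h; first by rewrite big_nil; exact: spanned0.
rewrite big_nat_recr //= addrC; apply: spanned_lin; first exact: h.
by apply: IH => i ni; apply: h; exact: ltnW.
Qed.

Lemma spanned_mem v d i : (i < d)%N -> spanned v d (v i).
Proof.
move=> id; exists (fun k => (k == i)%:R).
rewrite (bigD1_seq i) /= ?iota_uniq ?mem_index_iota // eqxx scale1r big1 ?addr0 //.
by move=> k /negbTE->; rewrite scale0r.
Qed.

Lemma spannedW v d x : spanned v d x -> spanned v d.+1 x.
Proof.
by move=> [a ->]; apply: spanned_sum => i id; apply: spanned_mem; exact: ltnW.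
Qed.

Definition orthonormal_below (u : nat -> H) d :=
  forall i j, (i < d)%N -> (j < d)%N -> dot (u i) (u j) = (i == j)%:R.

Lemma orthonormal_coef u d (a : nat -> R[i]) j : orthonormal_below u d -> (j < d)%N ->
  dot (\sum_(0 <= i < d) a i *: u i) (u j) = a j.
Proof.
move=> ou jd; rewrite linear_sumlz (bigD1_seq j) /= ?iota_uniq ?mem_index_iota //.
rewrite linearZl_LR /= ou // eqxx mulr1 big_seq_cond big1 ?addr0 //.
move=> i; rewrite mem_index_iota => /andP[/andP[_ id] /negbTE ij].
by rewrite linearZl_LR /= ou // ij mulr0.
Qed.

(** Independence takes the form that no vector lies in the span of its predecessors: exactly what
    makes the residual [w] nonzero, so that it can be normalized. *)
Lemma gram_schmidt (v : nat -> H) d :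
  (forall k, (k < d)%N -> ~ spanned v k (v k)) ->
  exists2 u, orthonormal_below u d & spanned v d = spanned u d.
Proof.
elim: d => [|d IH] iv.
  exists (fun=> 0) => //; apply/seteqP; split => x [a ->]; rewrite big_nil; exact: spanned0.
have [k kd|u ou vu] := IH; first by apply: iv; exact: ltnW.
pose w := v d - \sum_(0 <= i < d) dot (v d) (u i) *: u i.
have w0 : 0 < sqnorm w.
  rewrite lt_def sqnorm_ge0 // andbT; apply/eqP => /(sqnorm_eq0 dot_norm) /eqP.
  rewrite subr_eq0 => /eqP wE; apply: (iv d) => //; rewrite vu wE.
  by apply: spanned_sum => i; exact: spanned_mem.
have wu j : (j < d)%N -> dot w (u j) = 0.
  by move=> jd; rewrite linearBl /= orthonormal_coef // subrr.
pose c : R[i] := ((Num.sqrt (sqnorm w))^-1)%:C.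
pose u' i := if (i < d)%N then u i else c *: w.
have c0 : c != 0.
  by rewrite -sqnormc_eq0 sqnormcR sqrf_eq0 invr_eq0 sqrtr_eq0 -ltNge.
have u'd : u' d = c *: w by rewrite /u' ltnn.
have u'E i : (i < d)%N -> u' i = u i by rewrite /u' => ->.
have uu' x : spanned u d x -> spanned u' d.+1 x.
  by move=> [a ->]; apply: spanned_sum => i id; rewrite -u'E //; apply/spanned_mem/ltnW.
exists u'.
  move=> i j; rewrite ltnS leq_eqVlt => /predU1P[->|id]; rewrite ltnS leq_eqVlt => /predU1P[->|jd].
  - rewrite u'd (dot_sqnorm dot_norm) sqnormZ // sqnormcR exprVn sqr_sqrtr ?ltW // eqxx mulVf //.
    by rewrite gt_eqF.
  - by rewrite u'd u'E // linearZl_LR /= wu // mulr0 gtn_eqF.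
  - by rewrite u'd u'E // linearZr_LR /= dot_eq0C ?mulr0 ?ltn_eqF // wu.
  - by rewrite !u'E // ou.
apply/seteqP; split=> x [a ->]; apply: spanned_sum => i; rewrite ltnS leq_eqVlt => /predU1P[->|id].
- have -> : v d = c^-1 *: u' d + \sum_(0 <= i < d) dot (v d) (u i) *: u i.
    by rewrite u'd scalerA mulVf // scale1r subrK.
  apply: spanned_lin; first exact: spanned_mem.
  by apply: uu'; apply: spanned_sum => j; exact: spanned_mem.
- by apply: uu'; rewrite -vu; exact: spanned_mem.
- rewrite u'd; apply: spanned_scale; rewrite /w addrC -scaleN1r; apply: spanned_lin.
    by apply: spannedW; rewrite vu; apply: spanned_sum => j; exact: spanned_mem.
  exact: spanned_mem.
- by rewrite u'E //; apply: spannedW; rewrite vu; exact: spanned_mem.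
Qed.

Lemma has_dim_orthonormal (W : set H) d : has_dim W d ->
  exists2 u, orthonormal_below u d & W = spanned u d.
Proof.
move=> [v [iv vW]].
pose v' i := oapp v 0 (insub i : option 'I_d).
have v'E (i : 'I_d) : v' i = v i by rewrite /v' valK.
have WE : W = spanned v' d.
  apply/seteqP; split=> x.
    move=> /vW [c ->]; exists (fun i => oapp (c 0) 0 (insub i : option 'I_d)).
    by rewrite big_mkord; apply: eq_bigr => i _; rewrite v'E valK.
  move=> [a ->]; apply/vW; exists (\row_i a i).
  by rewrite big_mkord; apply: eq_bigr => i _; rewrite v'E mxE.
rewrite WE; apply: gram_schmidt => k kd [a vk].
(* Expressing [v k] by its predecessors gives a vanishing combination with coefficient -1 at [k],
   against independence. *)
have := iv (\row_(i < d) (if (i < k)%N then a i else if i == k :> nat then -1 else 0)).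
have -> : \sum_(i < d) (\row_(i < d) (if (i < k)%N then a i
    else if i == k :> nat then -1 else 0)) 0 i *: v i = 0.
  have E : \sum_(0 <= i < k) a i *: v' i = \sum_(i < d | (i < k)%N) a i *: v i.
    rewrite big_mkord (@big_ord_widen _ _ _ k d (fun i => a i *: v' i) (ltnW kd)).
    by apply: eq_bigr => i _; rewrite v'E.
  rewrite (bigID (fun i : 'I_d => (i < k)%N)) /=.
  under eq_bigr => i ik do rewrite mxE ik.
  rewrite -E -vk (bigD1 (Ordinal kd)) /= ?ltnn // mxE /= ltnn eqxx scaleN1r.
  rewrite -(v'E (Ordinal kd)) /= big1 ?addr0 ?subrr // => i /andP[/negbTE ik].
  by rewrite mxE ik -val_eqE /= => /negbTE ->; rewrite scale0r.
move=> /(_ erefl)/matrixP/(_ 0 (Ordinal kd)); rewrite !mxE /= ltnn eqxx.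
by move/eqP; rewrite oppr_eq0 oner_eq0.
Qed.

End Dimension.

Section Counting.
Context {R : realType}.
Implicit Types s : nat -> R.

Lemma c0star_lt s t : c0star s -> 0 < t -> exists N, forall n, (N <= n)%N -> s n < t.
Proof.
move=> [s0 _ cs] t0; move/cvgrPdist_lt : cs => /(_ _ t0) [N _ NP]; exists N => n /NP /=.
by rewrite sub0r normrN ger0_norm.
Qed.

Lemma c0star_finite s t : c0star s -> 0 < t -> finite_set [set n | s n = t].
Proof.
move=> cs t0; have [N NP] := c0star_lt cs t0.
apply: sub_finite_set (finite_II N) => n /= sn; rewrite ltnNge; apply/negP => /NP.
by rewrite sn ltxx.
Qed.

Lemma card_eq_proper (A B : set nat) k : finite_set A ->
  B `<=` A -> A k -> ~ B k -> ~ (A #= B)%card.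
Proof.
move=> fA BA An Bn AB.
have fB : finite_set B by exact: sub_finite_set fA.
have [m Bm] := fB.
have Am := card_eq_trans AB Bm.
suff : (#|` fset_set B| < #|` fset_set A|)%N by rewrite (card_fset_set Am) (card_fset_set Bm) ltnn.
apply: fproper_ltn_card; rewrite fproperEneq; apply/andP; split.
  by apply/eqP => E; apply: Bn; rewrite -(fset_setK fB) E /= in_fset_set // inE.
by apply/fsubsetP => x; rewrite !in_fset_set // !inE; exact: BA.
Qed.

(** At the first index [n] of disagreement, say with [s' n < s n], the level set of [s'] at the
    value [s n] lies below [n], where both sequences agree. It is thus a proper subset of the level
    set of [s], which is finite, so their cardinalities differ. *)
Lemma c0star_eq s s' : c0star s -> c0star s' ->
  (forall t, 0 < t -> ([set n | s n = t] #= [set n | s' n = t])%card) -> s = s'.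
Proof.
move=> cs cs' ss'; apply/funext => n; elim/ltn_ind: n => n IH.
wlog: s s' cs cs' ss' IH / s n > s' n => [hw|snlt].
  have [|h|//] := ltgtP (s n) (s' n); last exact: hw.
  move=> h; apply/esym; apply: hw => // [t t0|m mn]; last by rewrite IH.
  by rewrite card_eq_sym ss'.
have [s'0 s'd _] := cs'; have [s0 sd _] := cs.
have t0 : 0 < s n by apply: le_lt_trans snlt.
have lt_n m : s' m = s n -> (m < n)%N.
  move=> E; rewrite ltnNge; apply/negP => /s'd; rewrite E leNgt.
  by rewrite snlt.
exfalso; apply: (@card_eq_proper _ _ n _ _ _ _ (ss' _ t0)) => //.
- exact: c0star_finite.
- by move=> m /= E; rewrite IH // lt_n.
- by move=> /lt_n; rewrite ltnn.
Qed.

End Counting.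

Section SingularNumbers.
Context {R : realType} {H : completeNormedModType R[i]}.
Variable dot : {dot H for Num.conj}.
Hypothesis dot_norm : hilbert_norm dot.
Implicit Types (X : H -> H) (x y : H) (s : nat -> R).
Variable e : nat -> H.
Hypothesis e_basis : orthonormal_basis dot e.

Lemma singular_numbers_uniq X s s' :
  singular_numbers dot X s -> singular_numbers dot X s' -> s = s'.
Proof.
move=> [cs sX] [cs' s'X]; apply: c0star_eq => // t t0.
have [d hd sd] := sX _ t0; have [d' hd' sd'] := s'X _ t0.
by rewrite (card_eql sd) card_eq_sym (card_eql sd') (has_dim_uniq hd hd').
Qed.

Lemma c0star_le s n : c0star s -> s n <= s 0%N.
Proof. by case=> _ ds _; exact: ds. Qed.

Lemma c0star_sqnormc_le s : c0star s -> forall n, sqnormc ((s n)%:C) <= s 0%N ^+ 2.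
Proof.
move=> cs n; rewrite sqnormcR lerXn2r ?nnegrE ?c0star_le //; by case: cs.
Qed.

(** The eigenspace for [t ^ 2] is spanned by the basis vectors at the indices where [s] takes the
    value [t]; [f] enumerates them. *)
Lemma singular_numbers_diag s : c0star s -> singular_numbers dot (diagR_op dot e s) s.
Proof.
move=> cs; split=> // t t0; have [s0 _ _] := cs.
have sM := c0star_sqnormc_le cs.
have [d sd] := c0star_finite cs t0; exists d => //.
rewrite (adjoint_diagR dot_norm e_basis sM).
move: sd; rewrite card_eq_sym => /card_set_bijP [f [fF fI fS]].
have fN (i j : 'I_d) : (f i == f j) = (i == j).
  by apply/eqP/eqP => [/fI/val_inj -> //|->//]; rewrite inE /=.
have lin := bounded_op_linear (diag_bounded dot_norm e_basis sM).
have coord (c : 'rV[R[i]]_d) (j : 'I_d) : dot (\sum_(k < d) c 0 k *: e (f k)) (e (f j)) = c 0 j.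
  rewrite linear_sumlz (bigD1 j) //= linearZl_LR /= e_basis.1 eqxx mulr1 big1 ?addr0 //.
  by move=> k kj; rewrite linearZl_LR /= e_basis.1 fN (negbTE kj) mulr0.
have coord0 (c : 'rV[R[i]]_d) n : s n != t -> dot (\sum_(k < d) c 0 k *: e (f k)) (e n) = 0.
  move=> snt; rewrite linear_sumlz big1 // => k _; rewrite linearZl_LR /= e_basis.1.
  have [E|] := eqVneq (f k) n; last by rewrite mulr0.
  by have := fF k (ltn_ord k); rewrite /= E => /eqP; rewrite (negbTE snt).
have DD x n : dot (diagR_op dot e s (diagR_op dot e s x)) (e n) = (s n ^+ 2)%:C * dot x (e n).
  by rewrite /diagR_op !(diag_coord dot_norm e_basis sM) mulrA -realcM -expr2.
exists (fun k => e (f k)); split=> [c c0|x].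
  by apply/rowP => j; rewrite mxE -coord c0 linear0l.
split=> [/= xE|[c ->]]; last first.
  apply: (basis_coord_inj e_basis) => n; rewrite DD linearZl_LR /=.
  by have [->//|snt] := eqVneq (s n) t; rewrite coord0 // !mulr0.
exists (\row_k dot x (e (f k))); apply: (basis_coord_inj e_basis) => n.
have [snt|snt] := eqVneq (s n) t.
  have [k kd <-] := fS n snt.
  by rewrite -[k]/(val (Ordinal kd)) coord mxE.
have : ((s n ^+ 2)%:C - (t ^+ 2)%:C) * dot x (e n) = 0.
  by rewrite mulrBl -DD xE linearZl_LR subrr.
move/eqP; rewrite -rmorphB /= mulf_eq0 -sqnormc_eq0 sqnormcR sqrf_eq0 subr_eq0.
by rewrite eqrXn2 ?(ltW t0) // (negbTE snt) /= => /eqP ->; rewrite coord0.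
Qed.

Lemma adjoint_comp_selfadjoint X : bounded_op X -> forall x y,
  dot (adjoint dot X (X x)) y = dot x (adjoint dot X (X y)).
Proof.
by move=> bX x y; rewrite dotC -!(adjointP dot_norm e_basis) // -dotC.
Qed.

(** No spectral theorem is invoked: the definition of [singular_numbers] supplies the eigenspaces,
    and its bijection indexes an orthonormal basis of each by a level set of [s]. Distinct
    eigenvalues give orthogonal vectors by self-adjointness. The last clause says that the family
    exhausts every eigenspace with positive eigenvalue. *)
Lemma singular_vectors X s : bounded_op X -> singular_numbers dot X s ->
  exists v : nat -> H,
  [/\ forall m n, dot (v m) (v n) = ((m == n) && (0 < s m))%:R,
      forall n, adjoint dot X (X (v n)) = (s n ^+ 2)%:C *: v n
    & forall t x, 0 < t -> adjoint dot X (X x) = (t ^+ 2)%:C *: x ->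
        (forall n, dot x (v n) = 0) -> x = 0].
Proof.
move=> bX [cs sX].
have ch t : exists uf : (nat -> H) * (nat -> nat), 0 < t -> exists d : nat,
    [/\ orthonormal_below dot uf.1 d,
    [set v | adjoint dot X (X v) = (t ^+ 2)%:C *: v] = spanned uf.1 d
    & set_bij [set n | s n = t] `I_d uf.2].
  have [t0|t0] := boolP (0 < t); last by exists (fun=> 0, id).
  have [d hd /card_set_bijP [f fb]] := sX _ t0.
  have [u ou uW] := has_dim_orthonormal dot_norm hd.
  by exists (u, f) => _; exists d.
have [uf ufP] := choice ch.
(* Zero entries of [s] get the zero vector, since the definition says nothing about the kernel. *)
pose v n := if 0 < s n then (uf (s n)).1 ((uf (s n)).2 n) else 0.
have vE n : adjoint dot X (X (v n)) = (s n ^+ 2)%:C *: v n.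
  have bA := bounded_op_comp (adjoint_bounded dot_norm e_basis bX) bX.
  rewrite /v; case: ifP => [sn0|_]; last first.
    rewrite scaler0; have := linear_scale (bounded_op_linear bA) 0 0.
    by rewrite !scale0r.
  have [d [_ uW [fF _ _]]] := ufP _ sn0.
  suff : [set v | adjoint dot X (X v) = (s n ^+ 2)%:C *: v] ((uf (s n)).1 ((uf (s n)).2 n)) by [].
  by rewrite uW; apply: spanned_mem; exact: fF.
exists v; split=> // [m n|t x t0].
  have [->|mn] /= := eqVneq m n.
    rewrite /v; case: ifP => [sn0|_]; last by rewrite linear0l.
    by have [d [ou _ [fF _ _]]] := ufP _ sn0; rewrite ou ?eqxx //; exact: fF.
  have [smn|smn] := eqVneq (s m) (s n).
    rewrite /v smn; case: ifP => [sn0|_]; last by rewrite linear0l.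
    have [d [ou _ [fF fI _]]] := ufP _ sn0; rewrite ou; try exact: fF.
    by case: eqP => // /fI E; case/eqP: mn; apply: E; rewrite inE.
  have := adjoint_comp_selfadjoint bX (v m) (v n).
  rewrite !vE linearZl_LR linearZr_LR /= => /eqP.
  rewrite -subr_eq0 -[((s n ^+ 2)%:C)^*%R]/(((s n ^+ 2)%:C)^*%C) conjc_real -mulrBl mulf_eq0.
  rewrite -rmorphB /= -sqnormc_eq0 sqnormcR sqrf_eq0 subr_eq0.
  have s0 k : 0 <= s k by case: cs.
  by rewrite eqrXn2 // (negbTE smn) /= => /eqP.
move=> xE vx; have [d [ou uW [fF fI fS]]] := ufP _ t0.
have [a ax] : spanned (uf t).1 d x by rewrite -uW.
rewrite ax big_seq_cond big1 // => i; rewrite mem_index_iota andbT => /andP[_ id].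
have [n snt nE] := fS i id.
have := vx n; rewrite /v snt t0 nE ax orthonormal_coef // => ->.
by rewrite scale0r.
Qed.

End SingularNumbers.

(** * Ideals and their characteristic sets *)

Section Ideals.
Context {R : realType} {H : completeNormedModType R[i]}.
Variable dot : {dot H for Num.conj}.
Hypothesis dot_norm : hilbert_norm dot.
Local Notation sqnorm := (norm2 dot).
Variable e : nat -> H.
Hypothesis e_basis : orthonormal_basis dot e.
Variable I : set (H -> H).
Hypothesis I_ideal : operator_ideal I.

Definition bounded_seq (rho : nat -> R) := exists M : R, forall n, sqnormc ((rho n)%:C) <= M.

Lemma bounded_seq_diag rho : bounded_seq rho -> bounded_op (diagR_op dot e rho).
Proof. by case=> M rM; exact: diag_bounded rM. Qed.

Lemma c0star_bounded s : c0star s -> bounded_seq s.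
Proof. by move=> cs; exists (s 0%N ^+ 2); exact: c0star_sqnormc_le. Qed.

Lemma diagR_basis rho n : diagR_op dot e rho (e n) = (rho n)%:C *: e n.
Proof. by rewrite /diagR_op diag_basis. Qed.

Lemma ideal_diag_add rho rho' : bounded_seq rho -> bounded_seq rho' ->
  I (diagR_op dot e rho) -> I (diagR_op dot e rho') ->
  I (diagR_op dot e (fun n => rho n + rho' n)).
Proof.
move=> br br' Ir Ir'; have [_ _ Iadd _ _] := I_ideal.
suff <- : diagR_op dot e rho \+ diagR_op dot e rho' = diagR_op dot e (fun n => rho n + rho' n).
  exact: Iadd.
have bd := bounded_seq_diag br; have bd' := bounded_seq_diag br'.
have [M rM] := br; have [M' rM'] := br'.
apply: (bounded_op_eq e_basis).
- have [lT _] := bd; have [lT' _] := bd'; split.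
    by move=> a x y /=; rewrite lT lT' scalerDr addrACA.
  by move=> x; apply: continuousD; [case: bd => _; exact|case: bd' => _; exact].
- apply: bounded_seq_diag; exists (2 * M + 2 * M') => n.
  have := rM n; have := rM' n; rewrite !sqnormcR => h h'.
  have : 0 <= (rho n - rho' n) ^+ 2 by exact: sqr_ge0.
  nra.
- by move=> n /=; rewrite !diagR_basis realcD scalerDl.
Qed.

Lemma ideal_diag_le rho rho' M : bounded_seq rho -> (forall n, 0 <= rho' n <= M * rho n) ->
  (forall n, 0 <= rho n) -> I (diagR_op dot e rho) -> I (diagR_op dot e rho').
Proof.
move=> br rr' r0 Ir; have [_ _ _ Icomp _] := I_ideal.
(* The multiplier carrying [rho] to [rho']. Where [rho n = 0] the quotient is 0 by convention, and
   [rho' n] vanishes as well. *)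
pose q n := rho' n / rho n.
have qE n : q n * rho n = rho' n.
  rewrite /q; have [rn0|rn0] := eqVneq (rho n) 0; last by rewrite divfK.
  by have := rr' n; rewrite rn0 !mulr0 -eq_le => /eqP.
have bq : bounded_seq q.
  exists (M ^+ 2) => n; rewrite sqnormcR /q; have /andP[h0 h1] := rr' n.
  have [rn0|rn0] := eqVneq (rho n) 0; first by rewrite rn0 invr0 mulr0 expr0n sqr_ge0.
  have rp : 0 < rho n by rewrite lt_def rn0 r0.
  have h : 0 <= rho' n / rho n <= M by rewrite divr_ge0 //= ler_pdivrMr.
  have /andP[h2 h3] := h; nra.
suff <- : diagR_op dot e q \o diagR_op dot e rho = diagR_op dot e rho'.
  by apply: Icomp => //; exact: bounded_seq_diag.
have bd := bounded_seq_diag br; have bdq := bounded_seq_diag bq.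
apply: (bounded_op_eq e_basis); first exact: bounded_op_comp.
  have [M' rM'] := br; apply: bounded_seq_diag; exists (M ^+ 2 * M') => n.
  have := rM' n; have /andP[h0 h1] := rr' n; rewrite !sqnormcR => h.
  apply: (@le_trans _ _ ((M * rho n) ^+ 2)).
    by rewrite lerXn2r ?nnegrE // (le_trans h0).
  by rewrite exprMn ler_wpM2l ?sqr_ge0.
move=> n /=; rewrite !diagR_basis linear_scale; last exact: bounded_op_linear.
by rewrite diagR_basis scalerA -realcM mulrC qE.
Qed.

Lemma single_orth (k : nat) (x : H) i j : i != j ->
  dot (if i == k then x else 0) (if j == k then x else 0) = 0.
Proof.
move=> ij; have [ik|_] := eqVneq i k; last by rewrite linear0l.
by rewrite -ik eq_sym (negbTE ij) linear0r.
Qed.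

Lemma single_bounded (k : nat) (x : H) i : sqnorm (if i == k then x else 0) <= sqnorm x.
Proof. by case: ifP => // _; rewrite [leLHS]/norm2 linear0l sqnorm_ge0. Qed.

Lemma single_seq_bounded k (b : R) : bounded_seq (fun n => if n == k then b else 0).
Proof.
by exists (b ^+ 2) => n; rewrite sqnormcR; case: ifP => // _; rewrite expr0n sqr_ge0.
Qed.

(** Here the ideal has to be nonzero: an [X] in it with [X x != 0] is compressed by two operators of
    rank one to a multiple of the projection onto [e k]. *)
Lemma ideal_diag_single k (b : R) : I (diagR_op dot e (fun n => if n == k then b else 0)).
Proof.
have [Icpt [X IX [x Xx]] _ Il Ir] := I_ideal.
(* Normalized so that [dot (X x) y' = b]. *)
pose y' := (b / sqnorm (X x))%:C *: X x.
pose B := synth dot e (fun n => if n == k then x else 0).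
pose C := synth dot e (fun n => if n == k then y' else 0).
have bB : bounded_op B := synth_bounded dot_norm e_basis (single_orth k x) (single_bounded k x).
have bC : bounded_op C := synth_bounded dot_norm e_basis (single_orth k y') (single_bounded k y').
have bX : bounded_op X by case: (Icpt _ IX).
have baC := adjoint_bounded dot_norm e_basis bC.
suff <- : adjoint dot C \o (X \o B) = diagR_op dot e (fun n => if n == k then b else 0).
  by apply: Il => //; exact: Ir.
apply: (bounded_op_eq e_basis); first by do 2 apply: bounded_op_comp => //.
  by apply: bounded_seq_diag; exact: single_seq_bounded.
move=> n; apply: (basis_coord_inj e_basis) => m /=.
rewrite dotC -(adjointP dot_norm e_basis) // -dotC /B /C !(synth_basis e_basis) diagR_basis.
rewrite linearZl_LR /= e_basis.1.
have X0 : X 0 = 0 by have := linear_scale (bounded_op_linear bX) 0 0; rewrite !scale0r.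
have [nk|nk] := eqVneq n k; last by rewrite X0 linear0l mul0r.
have [mk|mk] := eqVneq m k; last first.
  by rewrite linear0r nk eq_sym (negbTE mk) mulr0.
rewrite nk mk eqxx mulr1 /y' linearZr_LR /= (dot_sqnorm dot_norm).
rewrite conjCR -realcM divfK //.
by apply: contra_neq Xx; exact: sqnorm_eq0.
Qed.

Lemma ideal_diag_finite rho N : (forall n, (N <= n)%N -> rho n = 0) -> I (diagR_op dot e rho).
Proof.
elim: N rho => [|N IH] rho rho0.
  have := ideal_diag_single 0 0; congr (I (diagR_op dot e _)); apply/funext => n.
  by rewrite rho0 //; case: ifP.
have -> : rho = fun n => (if n == N then 0 else rho n) + (if n == N then rho N else 0).
  by apply/funext => n; case: eqP => [->|]; rewrite ?add0r ?addr0.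
have finb (r : nat -> R) : (forall n, (N.+1 <= n)%N -> r n = 0) -> bounded_seq r.
  move=> r0; exists (\sum_(i < N.+1) r i ^+ 2) => n; rewrite sqnormcR.
  have [nN|nN] := ltnP n N.+1; last by rewrite r0 // expr0n sumr_ge0 // => i _; rewrite sqr_ge0.
  by rewrite (bigD1 (Ordinal nN)) //= lerDl sumr_ge0 // => i _; rewrite sqr_ge0.
apply: ideal_diag_add.
- by apply: finb => n Nn; case: ifP => // _; exact: rho0.
- exact: single_seq_bounded.
- apply: IH => n; rewrite leq_eqVlt eq_sym; case: eqP => //= _; exact: rho0.
- exact: ideal_diag_single.
Qed.

(** Truncations of [s] give elements of [I], hence compact operators, and they approximate uniformly
    because [s] tends to 0. *)
Lemma c0star_diag_compact s : c0star s -> compact_op (diagR_op dot e s).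
Proof.
move=> cs; apply: compact_op_approx.
  by apply: bounded_seq_diag; exact: c0star_bounded.
move=> eps eps0; have eE : eps = (complex.Re eps)%:C by rewrite RRe_real // gtr0_real.
have r0 : 0 < complex.Re eps by rewrite eE ltcR in eps0.
have [s0 _ _] := cs.
have [N NP] := c0star_lt cs r0.
pose s1 n := if (n < N)%N then s n else 0; pose s2 n := if (n < N)%N then 0 else s n.
have [Icpt _ _ _ _] := I_ideal.
exists (diagR_op dot e s1).
  by apply/Icpt/(@ideal_diag_finite _ N) => n; rewrite /s1 ltnNge => ->.
have b2 n : sqnormc ((s2 n)%:C) <= complex.Re eps ^+ 2.
  rewrite sqnormcR /s2; case: ltnP => nN; first by rewrite expr0n sqr_ge0.
  by rewrite lerXn2r ?nnegrE ?(ltW r0) // ltW // NP.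
have b1 n : sqnormc ((s1 n)%:C) <= s 0%N ^+ 2.
  rewrite sqnormcR /s1; case: ltnP => nN; last by rewrite expr0n sqr_ge0.
  by rewrite lerXn2r ?nnegrE ?c0star_le.
move=> x x1.
have -> : diagR_op dot e s x - diagR_op dot e s1 x = diagR_op dot e s2 x.
  apply: (basis_coord_inj e_basis) => n; rewrite linearBl /= /diagR_op.
  rewrite (diag_coord dot_norm e_basis (c0star_sqnormc_le cs)).
  rewrite (diag_coord dot_norm e_basis b1) (diag_coord dot_norm e_basis b2) -mulrBl.
  by rewrite /s1 /s2; case: ifP; rewrite ?subrr ?subr0.
rewrite (normr_sqnorm dot_norm) eE lecR -[leRHS]ger0_norm ?(ltW r0) // -sqrtr_sqr ler_wsqrtr //.
apply: le_trans (sqnorm_diag_le dot_norm e_basis b2 x) _.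
rewrite -[leRHS]mulr1 ler_wpM2l ?sqr_ge0 // -lecR -(normr2_sqnorm dot_norm).
by rewrite exprn_ile1.
Qed.

(* For singular vectors [v n] of [X] and [u n = X (v n) / s n], the operator
   [diag s] is [W^* X D], where [D] and [W] send [e n] to [v n] and [u n]. *)
Lemma charsetP s : charset dot I s <-> c0star s /\ I (diagR_op dot e s).
Proof.
have [Icpt _ _ Il Ir] := I_ideal.
split=> [[X IX Xs]|[cs Is]]; last by exists (diagR_op dot e s) => //; exact: singular_numbers_diag.
have [cs _] := Xs; split=> //.
have [s0 _ _] := cs.
have bX : bounded_op X by case: (Icpt _ IX).
have [v [ov Av _]] := singular_vectors dot_norm e_basis bX Xs.
pose u n := ((s n)^-1)%:C *: X (v n).
have XX m n : dot (X (v m)) (X (v n)) = (s n ^+ 2)%:C * ((m == n) && (0 < s m))%:R.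
  rewrite (adjointP dot_norm e_basis) // Av linearZr_LR /= ov.
  by rewrite conjCR.
have v_orth i j : i != j -> dot (v i) (v j) = 0 by move=> /negbTE ij; rewrite ov ij.
have v_b n : sqnorm (v n) <= 1.
  by rewrite /norm2 ov eqxx /=; case: (0 < s n); rewrite /= ?lexx ?ler01.
have u_orth i j : i != j -> dot (u i) (u j) = 0.
  by move=> /negbTE ij; rewrite /u linearZl_LR linearZr_LR /= XX ij !mulr0.
have u_b n : sqnorm (u n) <= 1.
  rewrite /u sqnormZ // sqnormcR /norm2 XX eqxx /=.
  have [sn|sn] := boolP (0 < s n); last by rewrite mulr0 /= mulr0.
  by rewrite mulr1 /= exprVn mulVf // expf_neq0 // gt_eqF.
have bD := synth_bounded dot_norm e_basis v_orth v_b.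
have bW := synth_bounded dot_norm e_basis u_orth u_b.
have baW := adjoint_bounded dot_norm e_basis bW.
suff <- : adjoint dot (synth dot e u) \o (X \o synth dot e v) = diagR_op dot e s.
  by apply: Il => //; exact: Ir.
apply: (bounded_op_eq e_basis); first by do 2 apply: bounded_op_comp => //.
  by apply: bounded_seq_diag; exact: c0star_bounded.
move=> n; apply: (basis_coord_inj e_basis) => m /=.
rewrite dotC -(adjointP dot_norm e_basis) // -dotC !(synth_basis e_basis) diagR_basis.
rewrite linearZl_LR /= e_basis.1 /u linearZr_LR /= XX.
rewrite conjCR mulrA -realcM.
have [->|nm] := eqVneq n m; last by rewrite !mulr0.
have [sm|sm] /= := ltP 0 (s m).
  by rewrite expr2 mulrA mulVf ?mul1r // gt_eqF.
by rewrite mulr0 mulr1; congr (_%:C); apply/eqP; rewrite eq_le s0 sm.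
Qed.

(** This holds for an arbitrary [S]: singular numbers are unique, and a diagonal operator realizes
    each sequence. The nested ideals of the closure can thus be unfolded without knowing that they
    are ideals. *)
Lemma charset_ideal_of (S : set (nat -> R)) s :
  charset dot (ideal_of dot S : set (H -> H)) s <-> c0star s /\ S s.
Proof.
split=> [[X [_ [s' Xs' Ss'] Xs]]|[cs Ss]].
  by rewrite (singular_numbers_uniq Xs Xs'); split=> //; case: Xs'.
exists (diagR_op dot e s); last exact: singular_numbers_diag.
split; first exact: c0star_diag_compact.
by exists s => //; exact: singular_numbers_diag.
Qed.

End Ideals.

(** * Majorization of sequences *)

Section Majorization.
Context {R : realType}.
Implicit Types (xi eta : nat -> R) (P A : nat -> nat -> R).

Lemma tail_cvg xi n : cvgn (series xi) ->
  (fun N => \sum_(n <= j < N) xi j) @ \oo --> limn (series xi) - \sum_(j < n) xi j.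
Proof.
move=> cxi.
suff : (fun N => series xi N - \sum_(j < n) xi j) @ \oo --> limn (series xi) - \sum_(j < n) xi j.
  apply: cvg_trans; apply: near_eq_cvg; near=> N.
  have nN : (n <= N)%N by near: N; exists n.
  by rewrite /series /= -(big_mkord xpredT) (big_cat_nat (leq0n n) nN) /= [LHS]addrC addKr.
by apply: cvgB; [exact: cxi|exact: cvg_cst].
Unshelve. all: by end_near. Qed.

Lemma tailE xi n : cvgn (series xi) ->
  \big[+%R/0]_(n <= j <oo) xi j = limn (series xi) - \sum_(j < n) xi j.
Proof. by move=> cxi; apply: cvg_lim => //; exact: tail_cvg. Qed.

Lemma partial_sum_le xi n : (forall j, 0 <= xi j) -> cvgn (series xi) ->
  \sum_(j < n) xi j <= limn (series xi).
Proof.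
move=> x0 cxi; rewrite -(big_mkord xpredT).
by apply: (nondecreasing_cvgn_le _ cxi n); apply: nondecreasing_series => k _ _.
Qed.

Lemma tail_ge0 xi n : (forall j, 0 <= xi j) -> cvgn (series xi) ->
  0 <= \big[+%R/0]_(n <= j <oo) xi j.
Proof. by move=> x0 cxi; rewrite tailE // subr_ge0 partial_sum_le. Qed.

(** When the totals agree, comparing tails is comparing initial sums in the opposite direction. *)
Lemma partial_sums_majorized xi eta : l1star xi -> l1star eta ->
  (forall n, \sum_(j < n) eta j <= \sum_(j < n) xi j) ->
  limn (series eta) = limn (series xi) -> strong_majorized_oo xi eta.
Proof.
move=> lxi leta h E; have [[_ cxi] [_ ceta]] := (lxi, leta).
split; last by rewrite (tailE 0 cxi) (tailE 0 ceta) !big_ord0 !subr0.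
by split=> // n; rewrite (tailE n cxi) (tailE n ceta) E lerB.
Qed.

Lemma partial_sums_strong_majorized xi eta : l1star xi -> l1star eta ->
  (forall n, \sum_(j < n) eta j <= \sum_(j < n) xi j) ->
  limn (series eta) = limn (series xi) -> strong_majorized eta xi.
Proof.
move=> lxi leta h E; have [[c0xi cxi] [c0eta ceta]] := (lxi, leta).
split=> //.
have cv : (fun n => (\sum_(j < n) (xi j - eta j))%:E) @ \oo -->
    (limn (series xi) - limn (series eta))%:E.
  apply: cvg_EFin; first by near=> n.
  rewrite (_ : _ \o _ = (fun n => series xi n - series eta n)).
    by apply: cvgB; [exact: cxi|exact: ceta].
  by apply/funext => n /=; rewrite /series /= !big_mkord -sumrB.
by rewrite (cvg_limn_einf_sup cv).1 E subrr.
Unshelve. all: by end_near. Qed.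

(** For summable sequences the differences of partial sums converge, so the vanishing liminf is a
    limit and means equality of the totals. *)
Lemma strong_majorized_tails xi eta : l1star xi -> l1star eta -> strong_majorized eta xi ->
  majorized_oo xi eta.
Proof.
move=> lxi leta [_ _ h lim0]; have [[_ cxi] [_ ceta]] := (lxi, leta).
have cv : (fun n => (\sum_(j < n) (xi j - eta j))%:E) @ \oo -->
    (limn (series xi) - limn (series eta))%:E.
  apply: cvg_EFin; first by near=> n.
  rewrite (_ : _ \o _ = (fun n => series xi n - series eta n)).
    by apply: cvgB; [exact: cxi|exact: ceta].
  by apply/funext => n /=; rewrite /series /= !big_mkord -sumrB.
move: lim0; rewrite (cvg_limn_einf_sup cv).1 => -[] /eqP; rewrite subr_eq0 => /eqP E.
by split=> // n; rewrite (tailE n cxi) (tailE n ceta) E lerB.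
Unshelve. all: by end_near. Qed.

(* Abel's trick: weights [w j <= 1] of total mass [<= n] do best on the first
   [n] terms of a nonincreasing sequence. *)
Lemma weighted_sum_le xi (w : nat -> R) n N : (forall j, 0 <= xi j) -> nonincreasing_seq xi ->
  (forall j, 0 <= w j <= 1) -> \sum_(j < N) w j <= n%:R ->
  \sum_(j < N) w j * xi j <= \sum_(j < n) xi j.
Proof.
move=> x0 dx w01 wn.
have [Nn|nN] := leqP N n.
  rewrite -(big_mkord xpredT (fun j => w j * xi j)) -(big_mkord xpredT xi).
  rewrite (big_cat_nat (leq0n N) Nn) /=.
  rewrite ler_wpDr ?sumr_ge0 // ler_sum // => j _.
  by have /andP[_ w1] := w01 j; rewrite ler_piMl.
apply: (@le_trans _ _ (\sum_(j < N) w j * (xi j - xi n) + n%:R * xi n)).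
  under eq_bigr do rewrite -[xi _](subrK (xi n)) mulrDr.
  by rewrite big_split /= -mulr_suml lerD2l ler_wpM2r.
rewrite -[leRHS](subrK (n%:R * xi n)) lerD2r.
have -> : \sum_(j < n) xi j - n%:R * xi n = \sum_(j < n) (xi j - xi n).
  by rewrite sumrB sumr_const card_ord mulr_natl.
rewrite -(big_mkord xpredT (fun j => w j * (xi j - xi n))).
rewrite -(big_mkord xpredT (fun j => xi j - xi n)) (big_cat_nat (leq0n n) (ltnW nN)) /=.
rewrite -[leRHS]addr0 lerD //.
  rewrite big_seq_cond [leRHS]big_seq_cond ler_sum // => j.
  rewrite mem_index_iota andbT => /andP[_ jn].
  have /andP[_ w1] := w01 j; rewrite ler_piMl // subr_ge0; exact/dx/ltnW.
rewrite big_seq_cond sumr_le0 // => j; rewrite mem_index_iota andbT => /andP[nj _].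
by have /andP[w0 _] := w01 j; rewrite mulr_ge0_le0 // subr_le0; exact: dx.
Qed.

(** Weaker than [column_stochastic] in the columns, because products with the matrix of singular
    vectors keep column sums 1 only on the support of the sequence. *)
Definition substochastic P :=
  [/\ forall i j, 0 <= P i j,
      forall i, (\sum_(0 <= j <oo) (P i j)%:E <= 1)%E
    & forall j, (\sum_(0 <= i <oo) (P i j)%:E <= 1)%E].

(** The sum of the first [n] entries of [eta] weights [xi j] by the sum of column [j] over [n] rows:
    each weight is at most 1, and the row sums bound their total by [n]. The totals agree by
    Tonelli, where columns at zeros of [xi] do not count. Monotonicity of [eta] is not assumed. *)
Lemma substochastic_majorization P xi eta : l1star xi -> substochastic P ->
  (forall j, xi j != 0 -> (\sum_(0 <= i <oo) (P i j)%:E = 1)%E) ->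
  (forall i, ((eta i)%:E = \sum_(0 <= j <oo) (P i j * xi j)%:E)%E) ->
  [/\ cvgn (series eta), limn (series eta) = limn (series xi)
    & forall n, \sum_(j < n) eta j <= \sum_(j < n) xi j].
Proof.
move=> [[x0 dx _] cxi] [P0 Prow Pcol] Pcol1 etaE.
have Px0 i j : (0 <= (P i j * xi j)%:E)%E by rewrite lee_fin mulr_ge0.
have eta0 i : 0 <= eta i by rewrite -lee_fin etaE nneseries_ge0.
have rowN i N : \sum_(j < N) P i j <= 1.
  rewrite -lee_fin -sumEFin -(big_mkord xpredT (fun j => (P i j)%:E)).
  by apply: le_trans (Prow i); apply: nneseries_lim_ge => j _ _; rewrite lee_fin.
have colN j n : \sum_(i < n) P i j <= 1.
  rewrite -lee_fin -sumEFin -(big_mkord xpredT (fun i => (P i j)%:E)).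
  by apply: le_trans (Pcol j); apply: nneseries_lim_ge => i _ _; rewrite lee_fin.
have part n : \sum_(i < n) eta i <= \sum_(i < n) xi i.
  rewrite -lee_fin -sumEFin -(big_mkord xpredT (fun i => (eta i)%:E)).
  under eq_bigr do rewrite etaE.
  rewrite -nneseries_sum_nat //.
  apply: lime_le; first by apply: is_cvg_nneseries => j _ _; exact: sume_ge0.
  near=> N; under eq_bigr do rewrite sumEFin.
  rewrite sumEFin lee_fin big_mkord.
  under eq_bigr do rewrite big_mkord -mulr_suml.
  apply: (@weighted_sum_le xi (fun j => \sum_(i < n) P i j)) => //.
    by move=> j; rewrite sumr_ge0 //= colN.
  rewrite exchange_big /= (@le_trans _ _ (\sum_(i < n) 1)) //.
    by apply: ler_sum => i _; exact: rowN.
  by rewrite sumr_const card_ord.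
have tot : (\sum_(i <oo) (eta i)%:E = (limn (series xi))%:E)%E.
  rewrite -(nneseries_lim_fin x0 cxi).
  under eq_eseriesr => i _ do rewrite etaE.
  rewrite nneseries_interchange //; apply: eq_eseriesr => j _.
  have [xj0|xj0] := eqVneq (xi j) 0.
    by rewrite xj0 eseries0 // => i _ _; rewrite mulr0.
  transitivity ((xi j)%:E * \sum_(0 <= i <oo) (P i j)%:E)%E; last by rewrite Pcol1 // mule1.
  rewrite -nneseriesZl; last by move=> i _; rewrite lee_fin.
  by apply: eq_eseriesr => i _; rewrite -EFinM mulrC.
have ceta : cvgn (series eta).
  apply: nondecreasing_is_cvgn; first by apply: nondecreasing_series => k _ _.
  exists (limn (series xi)) => _ [n _ <-]; rewrite /series /= big_mkord.
  exact: le_trans (part n) (partial_sum_le _ x0 cxi).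
split=> //; apply: EFin_inj; rewrite -tot.
exact/esym/nneseries_lim_fin.
Unshelve. all: by end_near. Qed.

End Majorization.

(** * Orthogonal direct sums *)

Section Horn.
Context {R : realType}.
Implicit Types a b : nat -> R.

(** [c] and [s] are the cosine and sine of the plane rotation that [horn] uses. *)
Lemma convex_comb (x y z : R) : x <= y <= z -> exists c s : R,
  c ^+ 2 + s ^+ 2 = 1 /\ c ^+ 2 * z + s ^+ 2 * x = y.
Proof.
move=> /andP[xy yz]; have [zx|zx] := eqVneq z x.
  exists 1, 0; rewrite !expr2 !mul0r !addr0 !mul1r; split => //.
  by apply/eqP; rewrite eq_le yz zx xy.
have xz : 0 < z - x by rewrite subr_gt0 lt_neqAle eq_sym zx (le_trans xy yz).
exists (Num.sqrt ((y - x) / (z - x))), (Num.sqrt ((z - y) / (z - x))).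
rewrite !sqr_sqrtr.
- by split; field; exact: lt0r_neq0.
- by rewrite divr_ge0 ?(ltW xz) // subr_ge0.
- by rewrite divr_ge0 ?(ltW xz) // subr_ge0.
Qed.

(* Schur-Horn for real orthogonal matrices: a plane rotation turns the first
   diagonal entry of [diag a] into [b 0] and changes only one other entry. *)
Lemma horn n a b :
  (forall i j, (i <= j <= n)%N -> b j <= b i) ->
  (forall m, (m <= n.+1)%N -> \sum_(i < m) b i <= \sum_(i < m) a i) ->
  \sum_(i < n.+1) b i = \sum_(i < n.+1) a i ->
  exists B : 'M[R]_n.+1, B *m B^T = 1%:M /\
    forall p, \sum_q B p q ^+ 2 * a q = b p.
Proof.
elim: n a b => [|n IH] a b b_noninc b_le b_eq.
  exists 1%:M; split; first by rewrite trmx1 mulmx1.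
  move=> p; rewrite [p]ord1 big_ord1 mxE eqxx expr1n mul1r.
  by move: b_eq; rewrite !big_ord1.
have b0a0 : b 0%N <= a 0%N by have := b_le 1%N isT; rewrite !big_ord1.
(* Otherwise every [a i] exceeds [b 0], hence [b i], against the equality of the totals. *)
have exk : exists k, (k <= n.+1)%N && (a k <= b 0%N).
  apply/not_existsP => nk.
  have lt_ab (i : 'I_n.+2) : b i < a i.
    have /negP := nk i; rewrite -ltnS ltn_ord /= -ltNge; apply: le_lt_trans.
    by apply: b_noninc; rewrite /= -ltnS ltn_ord.
  have : \sum_(i < n.+2) b i < \sum_(i < n.+2) a i.
    by apply: ltr_sum => //; apply/hasP; exists ord0; rewrite ?mem_index_enum.
  by rewrite b_eq ltxx.
case: (ex_minnP exk) => k /andP[kn ak] kmin.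
(* The partner of entry 0 in the rotation, indexed after entry 0 is removed. For [k = 0] one has
   [a 0 = b 0], and the rotation is trivial: [c = 1], [s = 0]. *)
pose k' := k.-1; have k'n : (k' <= n)%N by rewrite /k' -subn1 leq_subLR add1n.
have [c [s [cs1 cs2]]] : exists c s : R,
    c ^+ 2 + s ^+ 2 = 1 /\ c ^+ 2 * a 0%N + s ^+ 2 * a k'.+1 = b 0%N.
  case: k @k' ak {kmin kn k'n} => [|k] k' ak; last by apply: convex_comb; rewrite ak.
  exists 1, 0; rewrite !expr2 !mul0r !addr0 !mul1r; split => //.
  by apply/eqP; rewrite eq_le ak.
(* The other diagonal entries after the rotation; the trace is preserved, so the partner receives
   the excess [a 0 - b 0]. *)
pose a' i := a i.+1 + (if i == k' then a 0%N - b 0%N else 0).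
have a'sum m : \sum_(i < m) a' i =
    \sum_(i < m.+1) a i - (if (k' < m)%N then b 0%N else a 0%N).
  rewrite big_split [in RHS]big_ord_recl -big_mkcond /=.
  case: ifP => [km|km].
    have -> : \sum_(i < m | i == k' :> nat) (a 0%N - b 0%N) = a 0%N - b 0%N.
      exact: (big_pred1 (Ordinal km)).
    by rewrite addrA [X in _ = X - _]addrC.
  rewrite [X in _ + X]big_pred0; first by rewrite addr0 [RHS]addrC addKr.
  by move=> i; apply/negbTE/eqP => ik; rewrite -ik ltn_ord in km.
have [] := IH a' (fun i => b i.+1).
- by move=> i j /andP[ij jn]; apply: b_noninc; rewrite !ltnS ij.
- move=> m mn; rewrite a'sum; case: ifP => km.
    by rewrite lerBrDr addrC -(big_ord_recl m (fun i => b i)) b_le.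
  have {}km : (m <= k')%N by rewrite leqNgt km.
  rewrite [in leRHS]big_ord_recl /= [leRHS]addrC addKr; apply: ler_sum => i _.
  (* By minimality of [k], the entries of [a] before it exceed [b 0], so they dominate [b] term by
     term. *)
  have ik : (i.+1 < k)%N.
    have := leq_trans (ltn_ord i) km; rewrite /k'; by case: (k).
  have : ~~ (a i.+1 <= b 0%N).
    apply/negP => ai; have /kmin : (i.+1 <= n.+1)%N && (a i.+1 <= b 0%N).
      by rewrite ai andbT (leq_trans _ kn) // ltnW.
    by rewrite leqNgt ik.
  rewrite -ltNge => /ltW; apply: le_trans; apply: b_noninc => /=.
  exact: leq_trans (ltn_ord i) mn.
- by rewrite a'sum ltnS k'n -b_eq [in RHS]big_ord_recl /= [RHS]addrC addKr.
move=> B' [B'1 B'a]; pose K : 'I_n.+1 := inord k'.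
have KE : K = k' :> nat by rewrite inordK.
(* Entries of the product of the direct sum of 1 and [B'] with the rotation in the coordinates 0 and
   [K.+1]. *)
pose f i j : R := match unlift ord0 i, unlift ord0 j with
  | None, None => c
  | None, Some q => if q == K then s else 0
  | Some p, None => - s * B' p K
  | Some p, Some q => (if q == K then c else 1) * B' p q
  end.
pose B : 'M[R]_n.+2 := \matrix_(i, j) f i j.
have B00 : B ord0 ord0 = c by rewrite mxE /f unlift_none.
have B0S q : B ord0 (lift ord0 q) = if q == K then s else 0.
  by rewrite mxE /f unlift_none liftK.
have BS0 p : B (lift ord0 p) ord0 = - s * B' p K by rewrite mxE /f unlift_none liftK.
have BSS p q : B (lift ord0 p) (lift ord0 q) = (if q == K then c else 1) * B' p q.
  by rewrite mxE /f !liftK.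
have B'dot p p' : \sum_q B' p q * B' p' q = (p == p')%:R.
  have /matrixP/(_ p p') := B'1; rewrite !mxE => <-.
  by apply: eq_bigr => q _; rewrite mxE.
exists B; split.
  have Bdot i j : \sum_q B i q * B j q = (i == j)%:R -> (B *m B^T) i j = (1%:M : 'M[R]_n.+2) i j.
    by move=> h; rewrite mxE [RHS]mxE -h; apply: eq_bigr => q _; rewrite [B^T _ _]mxE.
  have B0 p : \sum_q B ord0 q * B (lift ord0 p) q = 0.
    rewrite big_ord_recl B00 BS0 (bigD1 K) //= B0S BSS eqxx big1; first by ring.
    by move=> q /negbTE qK; rewrite B0S qK mul0r.
  apply/matrixP => i j; apply: Bdot.
  case: (unliftP ord0 i) => [p|] ->; case: (unliftP ord0 j) => [p'|] ->.
  - rewrite (inj_eq (@lift_inj _ _)) -B'dot big_ord_recl !BS0 (bigD1 K) //= [RHS](bigD1 K) //=.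
    rewrite !BSS eqxx addrA; congr (_ + _); last first.
      by apply: eq_bigr => q /negbTE qK; rewrite !BSS qK !mul1r.
    have -> : B' p K * B' p' K = (c ^+ 2 + s ^+ 2) * (B' p K * B' p' K) by rewrite cs1 mul1r.
    by ring.
  - by under eq_bigr do rewrite mulrC; rewrite B0.
  - by rewrite B0.
  - rewrite big_ord_recl B00 (bigD1 K) //= B0S eqxx big1 ?addr0 -?expr2 //.
    by move=> q /negbTE qK; rewrite B0S qK mul0r.
move=> i; case: (unliftP ord0 i) => [p|] ->.
  rewrite -[RHS]/(b p.+1) -B'a big_ord_recl BS0 (bigD1 K) //= BSS eqxx.
  rewrite [RHS](bigD1 K) //= addrA; congr (_ + _).
    rewrite /a' KE eqxx /bump leq0n -cs2.
    have -> : a k'.+1 + (a 0%N - (c ^+ 2 * a 0%N + s ^+ 2 * a k'.+1)) =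
      s ^+ 2 * a 0%N + c ^+ 2 * a k'.+1 + (1 - (c ^+ 2 + s ^+ 2)) * (a 0%N + a k'.+1) by ring.
    by rewrite cs1 subrr mul0r addr0; ring.
  apply: eq_bigr => q qK; rewrite BSS (negbTE qK) mul1r /a' -KE (inj_eq val_inj) (negbTE qK).
  by rewrite addr0.
rewrite big_ord_recl B00 (bigD1 K) //= B0S eqxx big1 ?addr0.
  by rewrite /bump leq0n KE.
by move=> q /negbTE qK; rewrite B0S qK expr0n mul0r.
Qed.

End Horn.

Section Blocks.
Variable m : nat -> nat.

Definition bstart k := \sum_(l < k) (m l).+1.

Lemma bstartS k : bstart k.+1 = (bstart k + (m k).+1)%N.
Proof. by rewrite /bstart big_ord_recr. Qed.

Lemma bstart_le k l : (k <= l)%N -> (bstart k <= bstart l)%N.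
Proof.
move/subnK => <-; elim: (l - k)%N => // d; rewrite addSn bstartS => /leq_trans; apply.
exact: leq_addr.
Qed.

Lemma block_exists i : exists kp : nat * nat, (kp.2 <= m kp.1)%N /\ i = (bstart kp.1 + kp.2)%N.
Proof.
elim: i => [|i [[k p] /= [pm ->]]].
  by exists (0, 0)%N; split=> //; rewrite /bstart big_ord0.
have [pm'|pm'] := ltnP p (m k); first by exists (k, p.+1); split=> //=; rewrite addnS.
exists (k.+1, 0)%N; split=> //=; rewrite bstartS addn0 -addnS; congr (_ + _.+1)%N.
by apply/eqP; rewrite eqn_leq pm.
Qed.

Lemma block_uniq k l p q : (p <= m k)%N -> (q <= m l)%N ->
  (bstart k + p = bstart l + q)%N -> k = l /\ p = q.
Proof.
wlog: k l p q / (k <= l)%N => [hw|kl pm qm E].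
  have [kl|/ltnW lk] := leqP k l; first exact: hw.
  by move=> pm qm /esym E; have [-> ->] := hw _ _ _ _ lk qm pm E.
move: kl; rewrite leq_eqVlt => /predU1P[kl|kl].
  by move: E; rewrite kl => /addnI ->.
have := bstart_le kl; rewrite bstartS => h.
by have := leq_trans h (leq_addr q _); rewrite -E addnS ltn_add2l ltnNge pm.
Qed.

(** Rows and columns of a direct sum vanish outside one block, so series along them are finite
    sums. *)
Lemma series_block (R : realType) (f : nat -> R) k :
  (forall l q, (q <= m l)%N -> l != k -> f (bstart l + q)%N = 0) ->
  series f @ \oo --> \sum_(p < (m k).+1) f (bstart k + p)%N.
Proof.
move=> f0; apply: cvg_near_cst; near=> N.
have kN : (bstart k.+1 <= N)%N by near: N; exists (bstart k.+1).
have out j : (j < bstart k)%N || (bstart k.+1 <= j)%N -> f j = 0.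
  have [[l q] /= [ql ->]] := block_exists j => h; apply: f0 => //.
  apply: contraL h => /eqP lk; rewrite lk in ql *.
  by rewrite negb_or -leqNgt leq_addr /= -ltnNge bstartS ltn_add2l ltnS.
have kk : (bstart k <= bstart k.+1)%N by exact: bstart_le.
rewrite /series /= (big_cat_nat (leq0n _) (leq_trans kk kN)) (big_cat_nat kk kN) /=.
rewrite big_nat_cond big1 ?add0r => [|j /andP[/andP[_ jk] _]]; last by rewrite out ?jk.
rewrite [X in _ + X]big_nat_cond [X in _ + X]big1 ?addr0 => [|j /andP[/andP[jk _] _]]; last first.
  by rewrite out ?jk ?orbT.
rewrite bstartS -{1}(add0n (bstart k)) big_addn addKn big_mkord.
by apply: eq_bigr => i _; rewrite addnC.
Unshelve. all: by end_near. Qed.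

End Blocks.

Section OrthogonalDirectSums.
Context {R : realType}.
Implicit Types (U : nat -> nat -> R) (xi eta : nat -> R).

(** Row sums are diagonal entries of [B k *m (B k)^T], column sums those of the reversed product,
    which is the identity too because the blocks are square and finite. *)
Lemma orthogonal_direct_sum_stochastic U : orthogonal_direct_sum U ->
  column_stochastic (fun i j => U i j ^+ 2).
Proof.
move=> [m [B [BB UB U0]]].
have BB' k : (B k)^T *m B k = 1%:M by apply: mulmx1C; exact: BB.
split=> [i j|i|j]; first exact: sqr_ge0.
  have [[k p] /= [pm ->]] := block_exists m i.
  rewrite (@nneseries_lim_fin _ (fun j => U (bstart m k + p)%N j ^+ 2)
     _ (fun=> sqr_ge0 _) (@series_block m R _ k _)) ?lee_fin; last first.
    move=> l q ql lk; rewrite -ltnS in pm; rewrite -ltnS in ql.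
    by rewrite (U0 k l (Ordinal pm) (Ordinal ql)) ?expr0n // eq_sym.
  rewrite -ltnS in pm.
  have /matrixP/(_ (Ordinal pm) (Ordinal pm)) := BB k; rewrite !mxE eqxx mulr1n => <-.
  by apply: ler_sum => q _; rewrite !mxE -(UB k (Ordinal pm) q) expr2.
have [[k p] /= [pm ->]] := block_exists m j.
rewrite (@nneseries_lim_fin _ (fun j => U j (bstart m k + p)%N ^+ 2)
   _ (fun=> sqr_ge0 _) (@series_block m R _ k _)); last first.
  move=> l q ql lk; rewrite -ltnS in pm; rewrite -ltnS in ql.
  by rewrite (U0 l k (Ordinal ql) (Ordinal pm)) ?expr0n.
rewrite -ltnS in pm; congr (_%:E).
have /matrixP/(_ (Ordinal pm) (Ordinal pm)) := BB' k; rewrite !mxE eqxx mulr1n => <-.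
by apply: eq_bigr => q _; rewrite !mxE -(UB k q (Ordinal pm)) expr2.
Qed.

Lemma direct_sum_exists (m : nat -> nat) (B : forall k, 'M[R]_((m k).+1)) :
  (forall k, B k *m (B k)^T = 1%:M) ->
  exists U, orthogonal_direct_sum U /\ forall xi k (p : 'I_(m k).+1),
    mxseq (fun i j => U i j ^+ 2) xi (bstart m k + p)%N
     = \sum_q B k p q ^+ 2 * xi (bstart m k + q)%N.
Proof.
move=> BB; have [dec decP] := choice (block_exists m).
have decE k (p : 'I_(m k).+1) : dec (bstart m k + p)%N = (k, p : nat).
  have [h1 h2] := decP (bstart m k + p)%N.
  have [] := block_uniq (_ : (p <= m k)%N) h1 h2; first by rewrite -ltnS.
  by case: (dec _) => ? ? /= <- <-.
pose U i j : R := if (dec i).1 == (dec j).1 then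
  B (dec i).1 (inord (dec i).2) (inord (dec j).2) else 0.
have UB k (p q : 'I_(m k).+1) : U (bstart m k + p)%N (bstart m k + q)%N = B k p q.
  by rewrite /U !decE /= eqxx !inord_val.
have U0 k l (p : 'I_(m k).+1) (q : 'I_(m l).+1) :
    k != l -> U (bstart m k + p)%N (bstart m l + q)%N = 0.
  by move=> /negbTE kl; rewrite /U !decE /= kl.
exists U; split; first by exists m, B; split.
move=> xi k p; apply/cvg_lim => //.
have := @series_block m R (fun j => U (bstart m k + p)%N j ^+ 2 * xi j) k.
rewrite (eq_bigr (fun q => B k p q ^+ 2 * xi (bstart m k + q)%N)) => [|q _]; last by rewrite UB.
apply => l q ql lk; rewrite -ltnS in ql.
by rewrite (U0 k l p (Ordinal ql)) ?expr0n ?mul0r // eq_sym.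
Qed.

(* The block starting at [s] ends at the first [n > s] where the block sum of
   [2 eta] has caught up with that of [xi]; lowering the last entry of [2 eta]
   in the block makes the two sums equal.  Majorization within the blocks gives
   [eta' <= xi] at the first and [xi <= eta'] at the last entry of each block,
   so that [eta'] is nonincreasing across blocks too. *)
Lemma block_majorization xi eta : l1star xi -> c0star eta -> cvgn (series eta) ->
  (forall n, \big[+%R/0]_(n <= j <oo) xi j <= \big[+%R/0]_(n <= j <oo) eta j) ->
  exists2 U, orthogonal_direct_sum U &
    c0star (mxseq (fun i j => U i j ^+ 2) xi) /\
    forall i, mxseq (fun i j => U i j ^+ 2) xi i <= 2 * eta i.
Proof.
move=> [[x0 dx cx] cxi] [e0 de ce] ceta tails.
pose z j := 2 * eta j.
have exn s : exists n, (s < n)%N && (\sum_(s <= j < n) xi j <= \sum_(s <= j < n) z j).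
  (* If [xi s = 0], a block of length one will do. Otherwise the tail of [xi] from [s] is positive
     and strictly below that of [2 eta]. *)
  have [xs0|xs0] := eqVneq (xi s) 0.
    by exists s.+1; rewrite ltnSn !big_nat1 xs0 mulr_ge0.
  have tx : 0 < \big[+%R/0]_(s <= j <oo) xi j.
    apply: (@lt_le_trans _ _ (xi s)); first by rewrite lt_def xs0 x0.
    have := tail_ge0 s.+1 x0 cxi; rewrite (tailE s cxi) (tailE s.+1 cxi).
    by rewrite big_ord_recr /=; lra.
  have cv : (fun n => \sum_(s <= j < n) z j - \sum_(s <= j < n) xi j) @ \oo -->
      2 * \big[+%R/0]_(s <= j <oo) eta j - \big[+%R/0]_(s <= j <oo) xi j.
    apply: cvgB; last by rewrite (tailE s cxi); exact: tail_cvg.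
    rewrite (tailE s ceta).
    rewrite (_ : (fun n => _) = (fun n => 2 * \sum_(s <= j < n) eta j)).
      by apply: cvgM; [exact: cvg_cst|exact: tail_cvg].
    by apply/funext => n; rewrite mulr_sumr.
  have pos : 0 < 2 * \big[+%R/0]_(s <= j <oo) eta j - \big[+%R/0]_(s <= j <oo) xi j.
    by have := tails s; move: tx; lra.
  near \oo => n; exists n; apply/andP; split; first by near: n; exists s.+1.
  rewrite -subr_ge0 ltW //; near: n; exact: (cvgr_gt _ cv).
pose nxt s := ex_minn (exn s).
have nxt_gt s : (s < nxt s)%N by rewrite /nxt; case: ex_minnP => n /andP[].
have nxt_le s : \sum_(s <= j < nxt s) xi j <= \sum_(s <= j < nxt s) z j.
  by rewrite /nxt; case: ex_minnP => n /andP[].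
have nxt_min s n : (s < n < nxt s)%N -> \sum_(s <= j < n) z j <= \sum_(s <= j < n) xi j.
  rewrite /nxt; case: ex_minnP => N _ Nmin /andP[sn nN]; rewrite leNgt; apply/negP => h.
  by have := Nmin n; rewrite sn ltW // leqNgt nN => /(_ isT).
pose st k := iter k nxt 0%N.
pose m k := ((nxt (st k)) - (st k)).-1.
have mE k : (st k + (m k).+1)%N = nxt (st k).
  by rewrite /m prednK ?subn_gt0 // subnKC // ltnW.
have stE k : bstart m k = st k.
  by elim: k => [|k IH]; [rewrite /bstart big_ord0|rewrite bstartS IH mE].
pose eta' k p := if p == m k then
  \sum_(st k <= j < nxt (st k)) xi j - \sum_(st k <= j < (nxt (st k)).-1) z j
  else z (st k + p)%N.
have shift (f : nat -> R) k n : \sum_(i < n) f (st k + i)%N = \sum_(st k <= j < st k + n) f j.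
  rewrite -{2}(add0n (st k)) big_addn addKn big_mkord.
  by apply: eq_bigr => i _; rewrite addnC.
have lastE k : (nxt (st k)).-1 = (st k + m k)%N by rewrite -mE addnS.
have eta'lt k p : (p < m k)%N -> eta' k p = z (st k + p)%N by move=> pm; rewrite /eta' ltn_eqF.
have eta'last k : eta' k (m k) =
    \sum_(st k <= j < nxt (st k)) xi j - \sum_(st k <= j < st k + m k) z j.
  by rewrite /eta' eqxx lastE.
have eta'le k p : (p <= m k)%N -> eta' k p <= z (st k + p)%N.
  rewrite leq_eqVlt => /predU1P[->|pm]; last by rewrite eta'lt.
  rewrite eta'last lerBlDr; apply: le_trans (nxt_le _) _.
  by rewrite -mE addnS big_nat_recr ?leq_addr //= addrC.
(* Before its last entry, the block sum of [2 eta] is at most that of [xi], so making the sums equal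
   leaves at least the last entry of [xi]. *)
have last_ge k : xi (st k + m k)%N <= eta' k (m k).
  rewrite eta'last -mE addnS big_nat_recr ?leq_addr //= -addrA addrCA lerDl subr_ge0.
  case Em : (m k) => [|d]; first by rewrite addn0 !big_geq.
  by apply: nxt_min; rewrite -mE Em ltn_add2l ltnSn andbT addnS ltnS leq_addr.
have first_le k : eta' k 0%N <= xi (st k).
  case Em : (m k) => [|d].
    have := eta'last k; rewrite -mE Em => ->.
    by rewrite addn1 addn0 big_nat1 big_geq // subr0.
  rewrite eta'lt ?Em // addn0.
  have := @nxt_min (st k) (st k).+1; rewrite !big_nat1; apply.
  by rewrite ltnSn /= -mE Em addnS ltnS -addn1 leq_add2l.
have z_noninc i j : (i <= j)%N -> z j <= z i.
  by move=> ij; rewrite ler_wpM2l // de.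
have eta'noninc k p q : (p <= q)%N -> (q <= m k)%N -> eta' k q <= eta' k p.
  rewrite leq_eqVlt => /predU1P[->//|pq] qm.
  rewrite (eta'lt k p) ?(leq_trans pq) //.
  by apply: le_trans (eta'le k q qm) _; apply: z_noninc; rewrite leq_add2l ltnW.
have tot k : \sum_(p < (m k).+1) eta' k p = \sum_(p < (m k).+1) xi (st k + p)%N.
  rewrite big_ord_recr /= eta'last shift mE.
  rewrite (eq_bigr (fun p : 'I_(m k) => z (st k + p)%N)) => [|p _]; last by rewrite eta'lt.
  by rewrite shift addrC subrK.
have part k n : (n <= (m k).+1)%N ->
    \sum_(p < n) eta' k p <= \sum_(p < n) xi (st k + p)%N.
  rewrite leq_eqVlt => /predU1P[->|nm]; first by rewrite tot.
  rewrite (eq_bigr (fun p : 'I_n => z (st k + p)%N)) => [|p _]; last first.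
    by rewrite eta'lt // (leq_trans (ltn_ord p)).
  rewrite !shift; case: n nm => [|n] nm; first by rewrite addn0 !big_geq.
  by apply: nxt_min; rewrite -mE ltn_add2l nm andbT addnS ltnS leq_addr.
have hornB k := @horn _ (m k) (fun p => xi (st k + p)%N) (eta' k)
  (fun i j ij => eta'noninc k i j (andP ij).1 (andP ij).2) (part k) (tot k).
pose B k := sval (cid (hornB k)).
have BP k : B k *m (B k)^T = 1%:M /\
    forall p, \sum_q B k p q ^+ 2 * xi (st k + q)%N = eta' k p by exact: (svalP (cid (hornB k))).
have [U [Uods Uxi]] := direct_sum_exists (fun k => (BP k).1).
exists U => //; set y := mxseq _ xi.
have yE k (p : 'I_(m k).+1) : y (st k + p)%N = eta' k p.
  by rewrite /y -stE Uxi stE (BP k).2.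
have yE' k p : (p <= m k)%N -> y (st k + p)%N = eta' k p.
  by rewrite -ltnS => pm; exact: (yE k (Ordinal pm)).
have dec i : exists k p, (p <= m k)%N /\ i = (st k + p)%N.
  by have [[k p] [/= pm ->]] := block_exists m i; exists k, p; rewrite stE.
have y_le i : y i <= 2 * eta i.
  by have [k [p [pm ->]]] := dec i; rewrite yE' // eta'le.
have y_ge0 i : 0 <= y i.
  have [k [p [pm ->]]] := dec i; rewrite yE' //.
  by apply: le_trans (eta'noninc k p (m k) pm _) => //; exact: le_trans (last_ge k).
split=> //; split=> //.
  apply/nonincreasing_seqP => i.
  have [k [p [pm ->]]] := dec i; rewrite -addnS.
  move: pm; rewrite leq_eqVlt => /predU1P[->|pm].
    rewrite mE -[nxt (st k)]/(st k.+1) -[st k.+1]addn0 !yE' //.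
    apply: le_trans (first_le _) _; apply: le_trans (last_ge k).
    by rewrite -[st k.+1]/(nxt (st k)) -mE dx // addnS leqnSn.
  by rewrite !yE' ?(ltnW pm) // eta'noninc.
apply: (@squeeze_cvgr _ _ _ _ (fun=> 0) (fun n => 2 * eta n)).
- by near=> n; rewrite y_ge0 y_le.
- exact: cvg_cst.
- by rewrite -[X in _ --> X](mulr0 2); apply: cvgM => //; exact: cvg_cst.
Unshelve. all: by end_near. Qed.

End OrthogonalDirectSums.

(** * Products of substochastic matrices *)

Section Composition.
Context {R : realType}.
Implicit Types (P A : nat -> nat -> R) (xi d s : nat -> R).
Local Open Scope ereal_scope.

(** [Q] is the product of [A] and [P]; Tonelli in the extended reals covers every exchange of sums.
    Its entries are bounded by the column sums of [P], so [fine] loses nothing. *)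
Lemma substochastic_comp A P xi d s : (forall j, 0 <= xi j)%R ->
  substochastic A -> substochastic P ->
  (forall i, d i != 0%R -> \sum_(0 <= n <oo) (A n i)%:E = 1) ->
  (forall j, xi j != 0%R -> \sum_(0 <= i <oo) (P i j)%:E = 1) ->
  (forall i, (d i)%:E = \sum_(0 <= j <oo) (P i j * xi j)%:E) ->
  (forall n, (s n)%:E = \sum_(0 <= i <oo) (A n i * d i)%:E) ->
  exists2 Q, substochastic Q &
    (forall j, xi j != 0%R -> \sum_(0 <= n <oo) (Q n j)%:E = 1) /\
    (forall n, (s n)%:E = \sum_(0 <= j <oo) (Q n j * xi j)%:E).
Proof.
move=> x0 [A0 Ar Ac] [P0 Pr Pc] A1 P1 dE sE.
pose q n j := \sum_(0 <= i <oo) ((A n i)%:E * (P i j)%:E).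
have AP0 n i j : 0 <= (A n i)%:E * (P i j)%:E by rewrite mule_ge0 ?lee_fin.
have q0 n j : 0 <= q n j by apply: nneseries_ge0 => i _ _; exact: AP0.
have A_le1 n i : (A n i <= 1)%R.
  rewrite -lee_fin; apply: le_trans (Ar n).
  apply: le_trans (nneseries_lim_ge i.+1 _) => [|k _ _]; last by rewrite lee_fin.
  by rewrite big_nat_recr //= leeDr // sume_ge0 // => k _; rewrite lee_fin.
have q_fin n j : q n j \is a fin_num.
  rewrite ge0_fin_numE //; apply: (@le_lt_trans _ _ 1); last exact: ltry.
  apply: le_trans (Pc j); apply: lee_nneseries => [i _ _|i _]; first exact: AP0.
  by rewrite gee_pMl ?lee_fin.
have qE n j : (fine (q n j))%:E = q n j by rewrite fineK.
have row n : \sum_(0 <= j <oo) q n j =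
    \sum_(0 <= i <oo) ((A n i)%:E * \sum_(0 <= j <oo) (P i j)%:E).
  rewrite /q nneseries_interchange //; apply: eq_eseriesr => i _.
  by rewrite nneseriesZl // => j _; rewrite lee_fin.
have col j : \sum_(0 <= n <oo) q n j =
    \sum_(0 <= i <oo) ((P i j)%:E * \sum_(0 <= n <oo) (A n i)%:E).
  rewrite /q nneseries_interchange //; apply: eq_eseriesr => i _.
  rewrite -nneseriesZl; last by move=> n _; rewrite lee_fin.
  by apply: eq_eseriesr => n _; rewrite muleC.
have sum0 (f : nat -> R) : (forall i, 0 <= f i)%R -> 0 <= \sum_(0 <= i <oo) (f i)%:E.
  by move=> f0; apply: nneseries_ge0 => i _ _; rewrite lee_fin.
exists (fun n j => fine (q n j)).
  split=> [n j|n|j]; first exact: fine_ge0.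
    under eq_eseriesr do rewrite qE.
    rewrite row; apply: le_trans (Ar n); apply: lee_nneseries => [i _ _|i _].
      by rewrite mule_ge0 ?lee_fin ?sum0.
    by rewrite -[leRHS]mule1 lee_wpmul2l ?lee_fin.
  under eq_eseriesr do rewrite qE.
  rewrite col; apply: le_trans (Pc j); apply: lee_nneseries => [i _ _|i _].
    by rewrite mule_ge0 ?lee_fin // sum0.
  by rewrite -[leRHS]mule1 lee_wpmul2l ?lee_fin.
split=> [j xj|n].
  under eq_eseriesr do rewrite qE.
  rewrite col -(P1 _ xj); apply: eq_eseriesr => i _.
  (* If [P i j] is nonzero, then [d i >= P i j * xi j > 0], so column [i] of [A] has mass 1. *)
  have [->|Pij] := eqVneq (P i j) 0%R; first by rewrite mul0e.
  rewrite A1 ?mule1 //; apply: contra_neq Pij => di0.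
  have h : (P i j * xi j)%:E <= (d i)%:E.
    rewrite dE; apply: le_trans (nneseries_lim_ge j.+1 _) => [|k _ _]; last first.
      by rewrite lee_fin mulr_ge0.
    by rewrite big_nat_recr //= leeDr // sume_ge0 // => k _; rewrite lee_fin mulr_ge0.
  rewrite di0 lee_fin in h.
  have /eqP : (P i j * xi j = 0)%R by apply/eqP; rewrite eq_le h mulr_ge0.
  by rewrite mulf_eq0 (negbTE xj) orbF => /eqP.
rewrite sE.
transitivity (\sum_(0 <= i <oo) \sum_(0 <= j <oo) ((A n i)%:E * (P i j)%:E * (xi j)%:E)).
  apply: eq_eseriesr => i _; rewrite EFinM dE -nneseriesZl.
    by apply: eq_eseriesr => j _; rewrite EFinM muleA.
  by move=> j _; rewrite lee_fin mulr_ge0.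
rewrite nneseries_interchange; last by move=> i j; apply: mule_ge0; [exact: AP0|rewrite lee_fin].
apply: eq_eseriesr => j _; rewrite EFinM qE muleC /q -nneseriesZl //.
by apply: eq_eseriesr => i _; rewrite muleC.
Qed.

Lemma mxseq_cvg P xi : (forall j, 0 <= xi j)%R -> cvgn (series xi) ->
  (forall i j, 0 <= P i j <= 1)%R ->
  forall i, series (fun j => P i j * xi j)%R @ \oo --> mxseq P xi i.
Proof.
move=> x0 cxi P01 i.
have h : cvgn (series (fun j => P i j * xi j)%R).
  apply: (@series_le_cvg R _ xi) => // j.
    by have /andP[p0 _] := P01 i j; rewrite mulr_ge0.
  by have /andP[_ p1] := P01 i j; rewrite ler_piMl.
exact: h.
Qed.

Lemma mxseqE P xi : l1star xi -> substochastic P ->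
  forall i, (mxseq P xi i)%:E = \sum_(0 <= j <oo) (P i j * xi j)%:E.
Proof.
move=> [[x0 _ _] cxi] [P0 Pr _] i; apply/esym/nneseries_lim_fin.
  by move=> j; rewrite mulr_ge0.
apply: mxseq_cvg => // k j; rewrite P0 /= -lee_fin; apply: le_trans (Pr k).
apply: le_trans (nneseries_lim_ge j.+1 _) => [|l _ _]; last by rewrite lee_fin.
by rewrite big_nat_recr //= leeDr // sume_ge0 // => l _; rewrite lee_fin.
Qed.

Lemma column_stochastic_sub P : column_stochastic P -> substochastic P.
Proof. by move=> [P0 Pr Pc]; split=> // j; rewrite Pc. Qed.

End Composition.

(** * Squared matrices of operators *)

Section MatrixOperators.
Context {R : realType} {H : completeNormedModType R[i]}.
Variable dot : {dot H for Num.conj}.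
Hypothesis dot_norm : hilbert_norm dot.
Local Notation sqnorm := (norm2 dot).
Variable e : nat -> H.
Hypothesis e_basis : orthonormal_basis dot e.

(** Bessel's inequality for vectors of norm at most 1 rather than unit vectors, because some of the
    singular vectors may be zero. *)
Lemma bessel (v : nat -> H) (x : H) N :
  (forall i j, i != j -> dot (v i) (v j) = 0) -> (forall n, sqnorm (v n) <= 1) ->
  \sum_(n < N) sqnormc (dot (v n) x) <= sqnorm x.
Proof.
move=> ov v1; rewrite -(big_mkord xpredT (fun n => sqnormc (dot (v n) x))).
pose z := \sum_(0 <= n < N) dot x (v n) *: v n.
have := sqnorm_ge0 dot_norm (x - z); rewrite sqnormB.
have cJ n : sqnormc (dot x (v n)) = sqnormc (dot (v n) x) by rewrite dotC sqnormcJ.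
have -> : complex.Re (dot x z) = \sum_(0 <= n < N) sqnormc (dot (v n) x).
  rewrite -[RHS]/(complex.Re (\sum_(0 <= n < N) sqnormc (dot (v n) x))%:C); congr complex.Re.
  rewrite rmorph_sum linear_sumr; apply: eq_bigr => n _.
  by rewrite linearZr_LR /= -cJ sqnormcE mulrC.
have : sqnorm z <= \sum_(0 <= n < N) sqnormc (dot (v n) x).
  rewrite /z sqnorm_sum_nat //; last exact: orth_scale.
  apply: ler_sum => n _; rewrite sqnormZ // cJ ler_piMr ?sqnormc_ge0 //.
lra.
Qed.

Lemma dot_cvg_uniq (u : nat -> H) x y (a : nat -> R) (l : R) : u @ \oo --> x ->
  (forall n, dot (u n) y = (a n)%:C) -> a @ \oo --> l -> dot x y = l%:C.
Proof.
move=> ux ua al; apply: (sqnormc_lim_uniq (cvg_dot dot_norm y ux)).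
rewrite (_ : (fun n => _) = (fun n => (a n - l) * (a n - l))).
  rewrite -[X in _ --> X](mul0r 0) -(subrr l).
  by apply: cvgM; apply: cvgB => //; exact: cvg_cst.
by apply/funext => n; rewrite ua -rmorphB /= sqnormcR expr2.
Qed.

Lemma dot_real_coords x y (a b : nat -> R) (l : R) :
  (forall n, dot x (e n) = (a n)%:C) -> (forall n, dot y (e n) = (b n)%:C) ->
  series (fun n => a n * b n) @ \oo --> l -> dot x y = l%:C.
Proof.
move=> xa yb; apply: dot_cvg_uniq (e_basis.2 x) _ => n.
rewrite /series /= linear_sumlz rmorph_sum; apply: eq_bigr => i _.
by rewrite linearZl_LR /= [dot (e i) y]dotC xa yb realcM conjCR.
Qed.

Lemma diag_quadratic xi w : l1star xi ->
  (forall j, sqnormc (dot w (e j)) <= 1) ->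
  dot (diagR_op dot e xi w) w = (limn (series (fun j => sqnormc (dot w (e j)) * xi j)))%:C.
Proof.
move=> [c0xi cxi] w1; have [x0 _ _] := c0xi.
have cw : cvgn (series (fun j => sqnormc (dot w (e j)) * xi j)).
  apply: (@series_le_cvg R _ xi) => // j; first by rewrite mulr_ge0 // sqnormc_ge0.
  by rewrite ler_piMl.
have bu n : sqnorm ((xi n)%:C *: e n) <= xi 0%N ^+ 2.
  by rewrite sqnormZ // (basis_sqnorm e_basis) mulr1 c0star_sqnormc_le.
have ou := orth_scale (fun n => (xi n)%:C) (basis_orth e_basis).
rewrite /diagR_op diag_opE.
apply: (dot_cvg_uniq (synth_cvg dot_norm e_basis ou bu w)) cw => n.
rewrite /series /= linear_sumlz rmorph_sum; apply: eq_bigr => i _.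
by rewrite !linearZl_LR /= [dot (e i) w]dotC realcM sqnormcE mulrCA mulrC.
Qed.

Definition sqmatrix (V : H -> H) i j : R := sqnormc (dot (V (e j)) (e i)).

(** The [n]-th diagonal entry is the quadratic form of [diag xi] at the image of [e n] under the
    adjoint of [V], whose coordinates have the squared moduli [sqmatrix V n j]. *)
Lemma diag_expectationE V xi : bounded_op V -> l1star xi ->
  (forall i j, sqmatrix V i j <= 1) ->
  diag_expectation dot e (V \o diagR_op dot e xi \o adjoint dot V)
   = diagR_op dot e (mxseq (sqmatrix V) xi).
Proof.
move=> bV lxi V1; rewrite /diag_expectation /diagR_op; congr (diag_op dot e _).
have wE n j : sqnormc (dot (adjoint dot V (e n)) (e j)) = sqmatrix V n j.
  by rewrite dotC -(adjointP dot_norm e_basis) // sqnormcJ.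
apply/funext => n /=; rewrite (adjointP dot_norm e_basis) // diag_quadratic //.
  by congr (_ %:C); rewrite /mxseq; congr (limn (series _)); apply/funext => j; rewrite wE.
by move=> j; rewrite wE.
Qed.

(** Column sums are the squared norms of the [V (e j)]; row sums are those of the images of the
    [e i] under the adjoint, which is only a contraction. *)
Lemma isometry_sqmatrix V : isometry_op V -> column_stochastic (sqmatrix V).
Proof.
move=> [bV Viso].
have VE x : sqnorm (V x) = sqnorm x.
  by apply: complexI; rewrite -!(normr2_sqnorm dot_norm) Viso.
split=> [i j|i|j]; first exact: sqnormc_ge0.
  rewrite (_ : (\sum_(0 <= j <oo) _)%E = (sqnorm (adjoint dot V (e i)))%:E).
    rewrite lee_fin -(basis_sqnorm e_basis i) -[leRHS]mul1r.
    by apply: (sqnorm_adjoint_le dot_norm e_basis) => // x; rewrite VE mul1r.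
  rewrite -(parseval dot_norm e_basis); apply: eq_eseriesr => j _.
  by rewrite dotC -(adjointP dot_norm e_basis) // sqnormcJ.
by rewrite (parseval dot_norm e_basis) VE (basis_sqnorm e_basis).
Qed.

Lemma orthogonal_direct_sum_dot (U : nat -> nat -> R) j l : orthogonal_direct_sum U ->
  series (fun i => U i j * U i l) @ \oo --> ((j == l)%:R : R).
Proof.
move=> [m [B [BB UB U0]]].
have BB' k : (B k)^T *m B k = 1%:M by apply: mulmx1C; exact: BB.
have [[k p] /= [pm ->]] := block_exists m j.
have [[k' p'] /= [pm' ->]] := block_exists m l.
have := @series_block m R (fun i => U i (bstart m k + p)%N * U i (bstart m k' + p')%N) k.
move=> /(_ _)/cvg_trans; apply.
  move=> q r rq qk; rewrite -ltnS in rq; rewrite -ltnS in pm.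
  by rewrite (U0 q k (Ordinal rq) (Ordinal pm)) ?mul0r.
rewrite -ltnS in pm; rewrite -ltnS in pm'.
suff -> : \sum_(q < (m k).+1) U (bstart m k + q)%N (bstart m k + p)%N *
   U (bstart m k + q)%N (bstart m k' + p')%N =
   ((bstart m k + p)%N == (bstart m k' + p')%N)%:R by [].
have [kk|kk] := eqVneq k k'; last first.
  rewrite big1 => [|q _]; last by rewrite (U0 k k' q (Ordinal pm')) ?mulr0.
  case: eqP => // E; have [] := block_uniq (_ : (p <= m k)%N) (_ : (p' <= m k')%N) E => //.
  by move=> E'; rewrite E' eqxx in kk.
subst k'; rewrite eqn_add2l.
have /matrixP/(_ (Ordinal pm) (Ordinal pm')) := BB' k; rewrite !mxE => E.
rewrite -[(p == p')%:R]/((Ordinal pm == Ordinal pm')%:R) -E.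
by apply: eq_bigr => q _; rewrite !mxE -(UB k q (Ordinal pm)) -(UB k q (Ordinal pm')).
Qed.

(** The columns of [U] are the coordinates of an orthonormal sequence [u], and [W] sends [e j] to
    [u j]. *)
Lemma orthogonal_direct_sum_op (U : nat -> nat -> R) : orthogonal_direct_sum U ->
  exists2 W, isometry_op W & has_matrix dot e W U.
Proof.
move=> Uods; have UU j l := @orthogonal_direct_sum_dot U j l Uods.
pose u j := limn (series (fun i => (U i j)%:C *: e i)).
have ou j := orth_scale (fun i => (U i j)%:C) (basis_orth e_basis).
have sqn j i : sqnorm ((U i j)%:C *: e i) = U i j * U i j.
  by rewrite sqnormZ // (basis_sqnorm e_basis) mulr1 sqnormcR expr2.
have u_cvg j : series (fun i => (U i j)%:C *: e i) @ \oo --> u j.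
  have h : cvgn (series (fun i => (U i j)%:C *: e i)).
    apply: (orthogonal_series_cvg (M := 1) dot_norm (ou j)) => n.
    rewrite (eq_bigr (fun i => U i j * U i j)) => [|i _]; last exact: sqn.
    have hc : series (fun i => U i j * U i j) @ \oo --> (1 : R).
      by have := UU j j; rewrite eqxx.
    rewrite -(cvg_lim (@Rhausdorff R) hc).
    apply: (nondecreasing_cvgn_le _ _ n); last by apply/cvg_ex; eexists; exact: hc.
    by apply: nondecreasing_series => k _ _; rewrite -expr2 sqr_ge0.
  exact: h.
have u_coord j i : dot (u j) (e i) = (U i j)%:C.
  apply: (dot_lim dot_norm (u_cvg j)).
  near=> n; rewrite /series /= linear_sumlz.
  rewrite (bigD1_seq i) /= ?iota_uniq // ?mem_index_iota /=; last by near: n; exists i.+1.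
  rewrite linearZl_LR /= e_basis.1 eqxx mulr1 big1 ?addr0 // => k /negbTE ki.
  by rewrite linearZl_LR /= e_basis.1 ki mulr0.
have u_dot j l : dot (u j) (u l) = ((j == l)%:R : R)%:C.
  exact: dot_real_coords (u_coord j) (u_coord l) (UU j l).
have u_orth i j : i != j -> dot (u i) (u j) = 0 by move=> /negbTE ij; rewrite u_dot ij.
have u_sq j : sqnorm (u j) = 1 by rewrite /norm2 u_dot eqxx.
have u_bd j : sqnorm (u j) <= 1 by rewrite u_sq.
have bW := synth_bounded dot_norm e_basis u_orth u_bd.
exists (synth dot e u); split=> //.
  move=> x; rewrite !(normr_sqnorm dot_norm); congr ((Num.sqrt _)%:C).
  have h := parseval_cvg dot_norm e_basis x.
  have h' : series (fun n => sqnormc (dot x (e n))) @ \oo --> sqnorm (synth dot e u x).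
    have := sqnorm_synth_cvg dot_norm e_basis u_orth u_bd x.
    by under eq_fun do rewrite u_sq mulr1.
  exact: cvg_unique h' h.
by move=> i j; rewrite (synth_basis e_basis) u_coord.
Unshelve. all: by end_near. Qed.

End MatrixOperators.

(** * Arithmetic means at infinity *)

Section ArithmeticMean.
Context {R : realType}.
Implicit Types xi eta : nat -> R.

Lemma am_oo_c0star xi : l1star xi -> c0star (am_oo xi).
Proof.
move=> [[x0 _ _] cxi]; have am0 n : 0 <= am_oo xi n by rewrite mulr_ge0 ?tail_ge0.
split=> //.
  apply/nonincreasing_seqP => n; rewrite /am_oo ler_pM ?tail_ge0 //.
    by rewrite lef_pV2 ?posrE ?ltr0n // ler_nat.
  rewrite (tailE n.+1 cxi) (tailE n.+2 cxi) lerB //.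
  by rewrite [leRHS]big_ord_recr /= lerDl.
apply: (@squeeze_cvgr _ _ _ _ (fun=> 0) (fun n => n.+1%:R^-1 * limn (series xi))).
- near=> n; rewrite am0 /am_oo ler_wpM2l // (tailE n.+1 cxi) gerBl.
  exact: sumr_ge0.
- exact: cvg_cst.
- rewrite -[X in _ --> X](mul0r (limn (series xi))).
  by apply: cvgM; [exact: cvg_harmonic|exact: cvg_cst].
Unshelve. all: by end_near. Qed.

Lemma majorized_oo_am_le xi eta : majorized_oo xi eta -> forall n, am_oo xi n <= am_oo eta n.
Proof. by move=> [_ _ h] n; rewrite /am_oo ler_wpM2l. Qed.

(* The tail from index 0 is not controlled by [am_oo]; enlarging the first
   entry takes care of it. *)
Lemma am_le_majorized_oo xi eta M : l1star xi -> l1star eta -> 0 < M ->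
  (forall n, am_oo xi n <= M * am_oo eta n) ->
  majorized_oo xi (fun n => M * eta n + (if n == 0%N then xi 0%N else 0)).
Proof.
move=> lxi leta M0 h; have [[x0 dx cx] cxi] := lxi; have [[e0 de ce] ceta] := leta.
set z := fun n => _.
have z0 n : 0 <= z n by rewrite /z addr_ge0 ?mulr_ge0 ?(ltW M0) //; case: ifP.
have zE n : (n > 0)%N -> z n = M * eta n by rewrite /z; case: n => // n _; rewrite addr0.
have sums n : \sum_(j < n) z j = M * \sum_(j < n) eta j + (if n == 0%N then 0 else xi 0%N).
  rewrite big_split /= -mulr_sumr; congr (_ + _).
  by case: n => [|n]; rewrite ?big_ord0 // big_ord_recl /= big1 ?addr0.
have cz : series z @ \oo --> M * limn (series eta) + xi 0%N.
  suff : (fun n => M * series eta n + xi 0%N) @ \oo --> M * limn (series eta) + xi 0%N.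
    apply: cvg_trans; apply: near_eq_cvg; near=> n.
    have n0 : (n == 0%N) = false by apply/negbTE; rewrite -lt0n; near: n; exists 1%N.
    by rewrite /series /= !big_mkord sums n0.
  by apply: cvgD; [apply: cvgM; [exact: cvg_cst|exact: ceta]|exact: cvg_cst].
have lz : l1star z.
  split; last by apply/cvg_ex; eexists; exact: cz.
  split=> //.
    apply/nonincreasing_seqP => n; rewrite zE // /z.
    by rewrite ler_wpDr ?ler_wpM2l ?(ltW M0) ?de //; case: ifP.
  rewrite -(cvg_shiftn 1) /=.
  rewrite (_ : (fun n => _) = (fun n => M * eta (n + 1)%N)); last first.
    by apply/funext => n; rewrite zE ?addn1.
  have : (fun n => M * eta (n + 1)%N) @ \oo --> M * 0.
    apply: cvgM; first exact: cvg_cst.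
    by rewrite (cvg_shiftn 1 eta).
  by rewrite mulr0.
split=> // -[|n].
  rewrite (tailE 0 cxi) (tailE 0 lz.2) !big_ord0 !subr0 (cvg_lim (@Rhausdorff R) cz).
  have := h 0%N; rewrite /am_oo !invr1 !mul1r (tailE 1 cxi) (tailE 1 ceta) !big_ord1.
  by have := e0 0%N; nra.
have := h n; rewrite /am_oo mulrCA ler_pM2l ?invr_gt0 ?ltr0n //.
rewrite (tailE n.+1 lz.2) (cvg_lim (@Rhausdorff R) cz) sums /=.
rewrite (tailE n.+1 cxi) (tailE n.+1 ceta) mulrBr; lra.
Unshelve. all: by end_near. Qed.

End ArithmeticMean.

(** * Singular numbers of diagonal operators *)

Section DiagonalSingularNumbers.
Context {R : realType} {H : completeNormedModType R[i]}.
Variable dot : {dot H for Num.conj}.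
Hypothesis dot_norm : hilbert_norm dot.
Local Notation sqnorm := (norm2 dot).
Variable e : nat -> H.
Hypothesis e_basis : orthonormal_basis dot e.

(* [A n i] is the squared modulus of the [i]-th coordinate of the [n]-th
   singular vector of [diag d]. *)
Lemma diag_singular_matrix d s : (forall n, 0 <= d n) -> bounded_seq d ->
  singular_numbers dot (diagR_op dot e d) s ->
  exists A : nat -> nat -> R, [/\ substochastic A,
    forall i, d i != 0 -> (\sum_(0 <= n <oo) (A n i)%:E = 1)%E
  & forall n, ((s n)%:E = \sum_(0 <= i <oo) (A n i * d i)%:E)%E].
Proof.
move=> d0 bd ds; have [cs _] := ds; have [s0 _ _] := cs; have [M dM] := bd.
have [v [vv vE vC]] := singular_vectors dot_norm e_basis (bounded_seq_diag dot_norm e_basis bd) ds.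
have aD := adjoint_diagR dot_norm e_basis dM.
have DD x i : dot (adjoint dot (diagR_op dot e d) (diagR_op dot e d x)) (e i)
    = (d i ^+ 2)%:C * dot x (e i).
  by rewrite aD /diagR_op !(diag_coord dot_norm e_basis dM) mulrA -realcM -expr2.
have ov i j : i != j -> dot (v i) (v j) = 0 by move=> /negbTE ij; rewrite vv ij.
have v1 n : sqnorm (v n) = (0 < s n)%R%:R.
  by rewrite /norm2 vv eqxx /=; case: (0 < s n).
have v_le1 n : sqnorm (v n) <= 1 by rewrite v1; case: (0 < s n); rewrite ?ler01.
(* Comparing eigenvalues at coordinate [i]: the [n]-th singular vector lives where [d] equals
   [s n]. *)
have ds0 n i : d i != s n -> dot (v n) (e i) = 0.
  move=> dsn; have := DD (v n) i; rewrite vE linearZl_LR /= => /eqP.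
  rewrite -subr_eq0 -mulrBl mulf_eq0 -rmorphB /= -sqnormc_eq0 sqnormcR sqrf_eq0 subr_eq0.
  by rewrite eqrXn2 // eq_sym (negbTE dsn) /= => /eqP.
pose A n i := sqnormc (dot (v n) (e i)).
have A0 n i : 0 <= A n i by exact: sqnormc_ge0.
have Arow n : (\sum_(0 <= i <oo) (A n i)%:E = (sqnorm (v n))%:E)%E.
  by rewrite -(parseval dot_norm e_basis).
have colN i N : \sum_(n < N) A n i <= 1.
  by rewrite -(basis_sqnorm e_basis i); exact: bessel.
have Acol i : (\sum_(0 <= n <oo) (A n i)%:E <= 1)%E.
  apply: lime_le; first by apply: is_cvg_nneseries => n _ _; rewrite lee_fin.
  by near=> N; rewrite sumEFin lee_fin big_mkord.
exists A; split.
- by split=> // n; rewrite Arow lee_fin.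
- move=> i di; apply/eqP; rewrite eq_le Acol /=.
  have di0 : 0 < d i by rewrite lt_def di d0.
  have [N NP] := c0star_lt cs di0.
  (* Beyond [N] the singular vectors are orthogonal to [e i], so [e i - z] is orthogonal to all of
     them; it satisfies the eigenvalue equation for [d i ^ 2] and must vanish. Hence column [i] has
     mass 1 already in its first [N] entries. *)
  pose z := \sum_(0 <= n < N) dot (e i) (v n) *: v n.
  have lD := bounded_op_linear (bounded_op_comp
    (adjoint_bounded dot_norm e_basis (bounded_seq_diag dot_norm e_basis bd))
    (bounded_seq_diag dot_norm e_basis bd)).
  have ez : e i - z = 0.
    apply: (vC (d i)) => //.
      rewrite -[LHS]/((adjoint dot (diagR_op dot e d) \o diagR_op dot e d) (e i - z)).
      rewrite linear_sub // scalerBr; congr (_ - _).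
        apply: (basis_coord_inj e_basis) => j; rewrite /= DD linearZl_LR /= e_basis.1.
        by have [->//|_] := eqVneq i j; rewrite !mulr0.
      rewrite linear_sum_nat // scaler_sumr; apply: eq_bigr => n _.
      rewrite linear_scale //= vE !scalerA mulrC.
      have [->//|dsn] := eqVneq (d i) (s n).
      by rewrite dotC ds0 // rmorph0 !mulr0.
    move=> n; rewrite linearBl linear_sumlz /=.
    have [nN|nN] := ltnP n N.
      rewrite (bigD1_seq n) /= ?iota_uniq ?mem_index_iota // linearZl_LR /=.
      rewrite big1 ?addr0 => [|k kn]; last by rewrite linearZl_LR /= ov ?mulr0.
      rewrite vv eqxx /=; have [sn|sn] := ltP 0 (s n); first by rewrite mulr1 subrr.
      rewrite mulr0 subr0; apply/dot_eq0C/ds0.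
      by rewrite gt_eqF // (le_lt_trans sn).
    rewrite big_seq_cond big1 ?subr0 => [|k].
      by apply/dot_eq0C/ds0; rewrite gt_eqF // NP.
    rewrite mem_index_iota andbT => /andP[_ kN].
    by rewrite linearZl_LR /= ov ?mulr0 // ltn_eqF // (leq_trans kN).
  have h : 1 <= \sum_(0 <= n < N) A n i.
    rewrite -(basis_sqnorm e_basis i) (subr0_eq ez) /z sqnorm_sum_nat; last exact: orth_scale.
    apply: ler_sum => n _; rewrite sqnormZ // dotC sqnormcJ -/(A n i).
    by rewrite ler_piMr.
  rewrite -lee_fin -sumEFin in h; apply: le_trans h _.
  by apply: nneseries_lim_ge => n _ _; rewrite lee_fin.
(* Row [n] has mass 1 if [s n > 0]; otherwise it is zero and so is [s n]. On its support [d i] may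
   be replaced by [s n]. *)
- move=> n; transitivity ((s n)%:E * \sum_(0 <= i <oo) (A n i)%:E)%E.
    rewrite Arow v1 -EFinM; congr (_%:E).
    have [sn|sn] := ltP 0 (s n); first by rewrite mulr1.
    by rewrite mulr0; apply/eqP; rewrite eq_le sn s0.
  rewrite -nneseriesZl => [|i _]; last by rewrite lee_fin.
  apply: eq_eseriesr => i _; rewrite -EFinM; congr (_%:E).
  have [->|dsn] := eqVneq (d i) (s n); first by rewrite mulrC.
  by rewrite /A ds0 // /sqnormc /= !expr0n addr0 mulr0 mul0r.
Unshelve. all: by end_near. Qed.

End DiagonalSingularNumbers.

(** * Ideals of trace class operators *)

Section TraceClassIdeals.
Context {R : realType} {H : completeNormedModType R[i]}.
Variable dot : {dot H for Num.conj}.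
Hypothesis dot_norm : hilbert_norm dot.
Variable e : nat -> H.
Hypothesis e_basis : orthonormal_basis dot e.
Variable I : set (H -> H).
Hypotheses (I_ideal : operator_ideal I) (I_L1 : I `<=` trace_class dot).
Implicit Types xi eta : nat -> R.

Lemma charset_l1star eta : charset dot I eta -> l1star eta.
Proof.
move=> [X IX Xeta]; split; first by case: Xeta.
by have [_ [s Xs cs]] := I_L1 IX; rewrite (singular_numbers_uniq Xeta Xs).
Qed.

Lemma charset_le eta eta' M : charset dot I eta -> c0star eta' ->
  (forall n, eta' n <= M * eta n) -> charset dot I eta'.
Proof.
move=> /(charsetP dot_norm e_basis I_ideal) [ceta Ieta] ceta' le.
apply/(charsetP dot_norm e_basis I_ideal); split=> //.
have [e0 _ _] := ceta; have [e0' _ _] := ceta'.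
apply: (ideal_diag_le dot_norm e_basis I_ideal (M := M) _ _ e0 Ieta).
  exact: c0star_bounded.
by move=> n; rewrite e0' le.
Qed.

Lemma column_stochastic_charset P xi : l1star xi -> column_stochastic P ->
  charset dot I (mxseq P xi) ->
  strong_majorized_oo xi (mxseq P xi) /\ strong_majorized (mxseq P xi) xi.
Proof.
move=> lxi csP Ieta; have leta := charset_l1star Ieta.
have subP := column_stochastic_sub csP; have [_ _ Pc] := csP.
have [_ E part] := substochastic_majorization lxi subP (fun j _ => Pc j) (mxseqE lxi subP).
by split; [exact: partial_sums_majorized|exact: partial_sums_strong_majorized].
Qed.

(** The hypothesis concerns only the squared matrix, so that it covers both the isometries of (iv)
    and the operators of (iv'), which are given by their matrix. *)
Lemma ideal_expectation_majorized V xi : l1star xi -> bounded_op V ->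
  column_stochastic (sqmatrix dot e V) ->
  I (diag_expectation dot e (V \o diagR_op dot e xi \o adjoint dot V)) ->
  exists2 eta, charset dot I eta & strong_majorized_oo xi eta.
Proof.
move=> lxi bV csV; have [[x0 _ _] cxi] := lxi.
have subV := column_stochastic_sub csV; have [V0 _ Vc] := csV.
have V1 i j : sqmatrix dot e V i j <= 1.
  rewrite -lee_fin -(Vc j); apply: le_trans (nneseries_lim_ge i.+1 _) => [|l _ _].
    by rewrite big_nat_recr //= leeDr // sume_ge0 // => l _; rewrite lee_fin.
  by rewrite lee_fin.
rewrite (diag_expectationE dot_norm e_basis bV lxi V1); set d := mxseq _ xi => Id.
have dE := mxseqE lxi subV.
have [_ [s ds cs]] := I_L1 Id.
have d0 i : 0 <= d i.
  by rewrite -lee_fin dE nneseries_ge0 // => j _ _; rewrite lee_fin mulr_ge0.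
have bd : bounded_seq d.
  exists (limn (series xi) ^+ 2) => i; rewrite sqnormcR lerXn2r ?nnegrE //.
    by have := partial_sum_le 0 x0 cxi; rewrite big_ord0.
  rewrite -lee_fin dE -(nneseries_lim_fin x0 cxi); apply: lee_nneseries => [j _ _|j _].
    by rewrite lee_fin mulr_ge0.
  by rewrite lee_fin ler_piMl.
have [A [subA A1 sE]] := diag_singular_matrix dot_norm e_basis d0 bd ds.
have [Q subQ [Q1 Qs]] := substochastic_comp x0 subA subV A1 (fun j _ => Vc j) dE sE.
have [_ E part] := substochastic_majorization lxi subQ Q1 Qs.
have Is : charset dot I s by exists (diagR_op dot e d).
by exists s => //; apply: partial_sums_majorized => //; exact: charset_l1star.
Qed.

Lemma has_matrix_sqmatrix W U : has_matrix dot e W U ->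
  sqmatrix dot e W = fun i j => U i j ^+ 2.
Proof.
by move=> [_ WU]; apply/funext => i; apply/funext => j; rewrite /sqmatrix WU sqnormcR.
Qed.

Lemma majorized_oo_direct_sum xi eta : charset dot I eta -> majorized_oo xi eta ->
  exists2 U, orthogonal_direct_sum U & charset dot I (mxseq (fun i j => U i j ^+ 2) xi).
Proof.
move=> Ieta [lxi [c0eta ceta] tails].
have [U Uods [cU Ule]] := block_majorization lxi c0eta ceta tails.
by exists U => //; exact: charset_le Ieta cU Ule.
Qed.

(** One operator serves both (iv), as an isometry, and (iv'), through its matrix. *)
Lemma direct_sum_expectation xi U : l1star xi -> orthogonal_direct_sum U ->
  charset dot I (mxseq (fun i j => U i j ^+ 2) xi) ->
  exists2 W, isometry_op W & has_matrix dot e W U /\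
    I (diag_expectation dot e (W \o diagR_op dot e xi \o adjoint dot W)).
Proof.
move=> lxi Uods IU; have [W Wiso WU] := orthogonal_direct_sum_op dot_norm e_basis Uods.
have [bW _] := Wiso; have [_ WUE] := WU.
exists W => //; split=> //; rewrite (diag_expectationE dot_norm e_basis bW lxi).
  by rewrite (has_matrix_sqmatrix WU); case/(charsetP dot_norm e_basis I_ideal): IU.
have [Q0 _ Qc] := orthogonal_direct_sum_stochastic Uods.
move=> i j; rewrite (has_matrix_sqmatrix WU) -lee_fin -(Qc j).
apply: le_trans (nneseries_lim_ge i.+1 _) => [|l _ _]; last by rewrite lee_fin.
by rewrite big_nat_recr //= leeDr // sume_ge0 // => l _; rewrite lee_fin.
Qed.

(** As [I] consists of trace class operators, the intersection inside [am_oo_ideal] changes nothing,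
    and both layers unfold to a bound between arithmetic means at infinity. *)
Lemma charset_am_oo_closure xi : l1star xi ->
  charset dot (am_oo_closure dot I) xi <->
  exists2 eta, charset dot I eta & seqO (am_oo xi) (am_oo eta).
Proof.
move=> lxi; have ILE : I `&` trace_class dot = I by apply/setIidPl.
rewrite /am_oo_closure /pre_am_oo (charset_ideal_of dot_norm e_basis I_ideal) /=.
rewrite /am_oo_ideal (charset_ideal_of dot_norm e_basis I_ideal) /= ILE.
have cam := am_oo_c0star lxi.
by split=> [[_ [_ [_ [_ h]]]]//|h]; split; [case: lxi|split].
Qed.

Lemma charset_first_entry eta M b : charset dot I eta -> 0 < M ->
  c0star (fun n => M * eta n + (if n == 0%N then b else 0)) ->
  charset dot I (fun n => M * eta n + (if n == 0%N then b else 0)).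
Proof.
move=> /(charsetP dot_norm e_basis I_ideal) [ceta Ieta] M0 cz.
apply/(charsetP dot_norm e_basis I_ideal); split=> //.
have [e0 _ _] := ceta; have be := c0star_bounded ceta.
apply: (ideal_diag_add dot_norm e_basis I_ideal).
- have [B eB] := be; exists (M ^+ 2 * B) => n; have := eB n; rewrite !sqnormcR exprMn => h.
  by rewrite ler_wpM2l ?sqr_ge0.
- exact: single_seq_bounded.
- apply: (ideal_diag_le dot_norm e_basis I_ideal (M := M) be _ e0 Ieta) => n.
  by rewrite lexx mulr_ge0 // ltW.
- exact: ideal_diag_single.
Qed.

End TraceClassIdeals.

(** The implications form one cycle in the listed order. Most of them pass through tail domination
    and construct a fresh [U] from it, instead of reusing the matrix or isometry at hand. *)
Theorem theorem8p3 (R : realType) (H : completeNormedModType R[i])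
    (dot : {dot H for Num.conj}) (dot_norm : hilbert_norm dot)
    (e : nat -> H) (e_basis : orthonormal_basis dot e)
    (I : set (H -> H)) (I_ideal : operator_ideal I)
    (I_L1 : I `<=` trace_class dot)
    (xi : nat -> R) (xi_l1 : l1star xi) :
  [<-> (* (i) *)
       charset dot (am_oo_closure dot I) xi;
       (* (ii) *)
       exists2 eta, charset dot I eta & majorized_oo xi eta;
       (* (ii') *)
       exists2 eta, charset dot I eta & strong_majorized_oo xi eta;
       (* (ii'') *)
       exists2 eta, charset dot I eta & strong_majorized eta xi;
       (* (iii) *)
       exists2 P, column_stochastic P & charset dot I (mxseq P xi);
       (* (iii') *)
       exists2 Q, block_orthostochastic Q & charset dot I (mxseq Q xi);
       (* (iv) *)
       exists2 V, isometry_op V &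
         I (diag_expectation dot e (V \o diagR_op dot e xi \o adjoint dot V));
       (* (iv') *)
       exists2 U, orthogonal_direct_sum U &
         exists2 W, has_matrix dot e W U &
           I (diag_expectation dot e (W \o diagR_op dot e xi \o adjoint dot W))].
Proof.
have ii_iiip eta : charset dot I eta -> majorized_oo xi eta ->
    exists2 U, orthogonal_direct_sum U & charset dot I (mxseq (fun i j => U i j ^+ 2) xi).
  exact: (majorized_oo_direct_sum dot_norm e_basis I_ideal).
tfae.
- move=> /(charset_am_oo_closure dot_norm e_basis I_ideal I_L1 xi_l1) [eta Ieta [M M0 h]].
  have maj := am_le_majorized_oo xi_l1 (charset_l1star I_L1 Ieta) M0 h.
  eexists; last exact: maj.
  by apply: (charset_first_entry dot_norm e_basis I_ideal) => //; case: maj => _ [].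
(* The witness [eta] is exchanged for [Q xi], which has the total of [xi]; the same exchange gives
   the next implication. *)
- move=> [eta Ieta /(ii_iiip _ Ieta) [U /orthogonal_direct_sum_stochastic Q IQ]].
  eexists; first exact: IQ.
  by have [] := column_stochastic_charset I_L1 xi_l1 Q IQ.
- move=> [eta Ieta [/(ii_iiip _ Ieta) [U /orthogonal_direct_sum_stochastic Q IQ] _]].
  eexists; first exact: IQ.
  by have [] := column_stochastic_charset I_L1 xi_l1 Q IQ.
- move=> [eta Ieta /(strong_majorized_tails xi_l1 (charset_l1star I_L1 Ieta))].
  move=> /(ii_iiip _ Ieta) [U /orthogonal_direct_sum_stochastic Q IQ].
  by eexists; [exact: Q|].
- move=> [P csP IP]; have [[maj _] _] := column_stochastic_charset I_L1 xi_l1 csP IP.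
  have [U Uods IU] := ii_iiip _ IP maj.
  by exists (fun i j => U i j ^+ 2) => //; exists U.
- move=> [Q [U Uods QU] IQ].
  have QE : Q = fun i j => U i j ^+ 2 by apply/funext => i; apply/funext => j.
  rewrite QE in IQ.
  have [W Wiso [_ IW]] := direct_sum_expectation dot_norm e_basis I_ideal xi_l1 Uods IQ.
  by exists W.
(* [V] serves only to produce a majorizing [eta]; the new [U] is built from that. *)
- move=> [V Viso IV].
  have [eta Ieta [maj _]] := ideal_expectation_majorized dot_norm e_basis I_L1 xi_l1
    Viso.1 (isometry_sqmatrix dot_norm e_basis Viso) IV.
  have [U Uods IU] := ii_iiip _ Ieta maj.
  have [W _ [WU IW]] := direct_sum_expectation dot_norm e_basis I_ideal xi_l1 Uods IU.
  by exists U => //; exists W.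
- move=> [U Uods [W WU IW]].
  have csW : column_stochastic (sqmatrix dot e W).
    by rewrite (has_matrix_sqmatrix WU); exact: orthogonal_direct_sum_stochastic.
  have [eta Ieta [maj _]] := ideal_expectation_majorized dot_norm e_basis I_L1 xi_l1
    WU.1 csW IW.
  apply/(charset_am_oo_closure dot_norm e_basis I_ideal I_L1 xi_l1); exists eta => //.
  by exists 1 => // n; rewrite mul1r; exact: majorized_oo_am_le.
Qed.
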